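(* Let $H=R_{r,H}^{1/2}Z_HR_{t,H}^{1/2}$ be a random $N_R\times N_S$ matrix, where $Z_H$ is an $N_R\times N_S$ random matrix with independent, zero-mean, unit-variance, proper complex Gaussian entries, and $R_{r,H}$, $R_{t,H}$ are deterministic positive semidefinite matrices with $R_{r,H}^{1/2}=U_{r,H}\Lambda_{r,H}^{1/2}U_{r,H}^H$ and $R_{t,H}^{1/2}=U_{t,H}\Lambda_{t,H}^{1/2}U_{t,H}^H$ (eigenvalue decompositions). Let $G\in\mathbb{C}^{N_D\times N_R}$ be deterministic. Consider the problem of maximizing, over $Q\in\mathbb{C}^{N_S\times N_S}$ and $A\in\mathbb{C}^{N_R\times N_R}$, $$\frac{\mathbb{E}_{Z_H}\left[\log\frac{\left|\sigma_D^2I_{N_D}+GA(HQH^H+\sigma_R^2I_{N_R})A^HG^H\right|}{\left|\sigma_D^2I_{N_D}+\sigma_R^2GAA^HG^H\right|}\right]}{\mathbb{E}_{Z_H}\left[\mathrm{tr}(A(HQH^H+\sigma_R^2I_{N_R})A^H)\right]+\mathrm{tr}(Q)+P_c}$$ subject to $\mathbb{E}_{Z_H}[\mathrm{tr}(A(HQH^H+\sigma_R^2I_{N_R})A^H)]\le P_R^{max}$, $\mathrm{tr}(Q)\le P_S^{max}$, $Q\succeq0$, and $$\mathbb{E}_{Z_H}\left[\log\frac{\left|\sigma_D^2I_{N_D}+GA(HQH^H+\sigma_R^2I_{N_R})A^HG^H\right|}{\left|\sigma_D^2I_{N_D}+\sigma_R^2GAA^HG^H\right|}\right]\ge R_S^{min}.$$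 Write the eigenvalue decomposition of $Q$ as $Q=U_Q\Lambda_QU_Q^H$. Then, for any matrix $A$, the optimal $Q$ is such that $U_Q=U_{t,H}$.
   Context: $|\cdot|$ is the determinant, $(\cdot)^H$ the conjugate transpose, $\mathrm{tr}$ the trace, $I_n$ the $n\times n$ identity; $Q\succeq 0$ means that $Q$ is Hermitian positive semidefinite. The constants $\sigma_R^2,\sigma_D^2$ (noise variances), $P_c$ (circuit power), $P_S^{max},P_R^{max}$ (maximum powers) are positive, and $R_S^{min}\ge0$ is a minimum rate. In all eigenvalue decompositions (of $R_{r,H}^{1/2}$, $R_{t,H}^{1/2}$ and $Q$), the eigenvalues are arranged in decreasing order; $U_{r,H},U_{t,H},U_Q$ are unitary and $\Lambda_{r,H},\Lambda_{t,H},\Lambda_Q$ are diagonal with non-negative entries.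
   Formalization: The eigenvalues of Q are not required to be in decreasing order (they follow the columns of U_{t,H}), as the claim is false otherwise; every optimal Q has U_Q = U_{t,H} when its rate is positive, and if the rate is zero only some optimal Q is claimed to have it. *)

(* Defs.v *)
From HB Require Import structures.
From mathcomp Require Import all_boot all_order all_algebra.
From mathcomp Require Import sesquilinear spectral complex.
From mathcomp Require Import all_classical all_reals all_analysis.

Set Implicit Arguments.
Unset Strict Implicit.
Unset Printing Implicit Defensive.

Import Order.TTheory GRing.Theory Num.Theory.

Local Open Scope classical_set_scope.
Local Open Scope ring_scope.
Local Open Scope complex_scope.
Local Open Scope sesquilinear_scope.

(* In [R[i]], [0 <= z] means that z is real and nonnegative. *)
Definition psd (R : realType) (n : nat) (Q : 'M[R[i]]_n) : Prop :=
  Q \is hermsymmx /\ forall x : 'cV[R[i]]_n, 0 <= (x^t* *m Q *m x) 0 0.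

Definition diagC (R : realType) (n : nat) (l : 'rV[R]_n) : 'M[R[i]]_n :=
  diag_mx (map_mx (real_complex R) l).

(* Q = U diag(l) U^H; the columns of U are the eigenvectors.  The ordering of
   the eigenvalues is a separate predicate, [decreasing]. *)
Definition evd (R : realType) (n : nat)
    (U : 'M[R[i]]_n) (l : 'rV[R]_n) (Q : 'M[R[i]]_n) : Prop :=
  [/\ U \is unitarymx, forall i, 0 <= l 0 i & Q = U *m diagC l *m U^t*].

Definition decreasing (R : realType) (n : nat) (l : 'rV[R]_n) : Prop :=
  forall i j : 'I_n, (i <= j)%N -> l 0 j <= l 0 i.

Definition evd_sqrt (R : realType) (n : nat)
    (U : 'M[R[i]]_n) (l : 'rV[R]_n) : 'M[R[i]]_n :=
  U *m diagC (map_mx Num.sqrt l) *m U^t*.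

Definition reim (R : realType) (z : R[i]) : R * R :=
  (complex.Re z, complex.Im z).

Definition complex_random_variable (d : measure_display)
    (T : measurableType d) (R : realType) (X : T -> R[i]) : Prop :=
  measurable_fun [set: T] (fun w => reim (X w)).

(* Proper (circularly symmetric) complex Gaussian of mean m and variance
   E|X - m|^2 = v: Re X and Im X are independent real Gaussians, each of
   variance v/2.  The second argument of [normal_prob] is the standard
   deviation. *)
Definition proper_complex_gaussian (d : measure_display)
    (T : measurableType d) (R : realType) (P : probability T R)
    (m : R[i]) (v : R) (X : T -> R[i]) : Prop :=
  complex_random_variable X /\
  forall B : set (R * R), measurable B ->
    P ((fun w => reim (X w)) @^-1` B) =
    (normal_prob (complex.Re m) (Num.sqrt (v / 2)) \x
     normal_prob (complex.Im m) (Num.sqrt (v / 2)))%E B.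

Definition mutually_independent (d : measure_display)
    (T : measurableType d) (R : realType) (P : probability T R)
    (I : finType) (X : I -> T -> R[i]) : Prop :=
  forall (J : {set I}) (B : I -> set (R * R)),
    (forall i, measurable (B i)) ->
    P (\bigcap_(i in [set` J]) ((fun w => reim (X i w)) @^-1` B i)) =
    (\prod_(i in J) P ((fun w => reim (X i w)) @^-1` B i))%E.

Definition iid_standard_complex_gaussian (d : measure_display)
    (T : measurableType d) (R : realType) (P : probability T R)
    (m n : nat) (Z : T -> 'M[R[i]]_(m, n)) : Prop :=
  (forall i j, proper_complex_gaussian P 0 1 (fun w => Z w i j)) /\
  mutually_independent P (fun (k : 'I_m * 'I_n) w => Z w k.1 k.2).

Definition channel (T : Type) (R : realType) (NR NS : nat)
    (Ur : 'M[R[i]]_NR) (lr : 'rV[R]_NR) (Ut : 'M[R[i]]_NS) (lt : 'rV[R]_NS)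
    (Z : T -> 'M[R[i]]_(NR, NS)) (w : T) : 'M[R[i]]_(NR, NS) :=
  evd_sqrt Ur lr *m Z w *m evd_sqrt Ut lt.

(* H Q H^H + sigma_R^2 I; [sR2] and [sD2] stand for the noise variances. *)
Definition rx_cov (R : realType) (NR NS : nat) (sR2 : R)
    (H : 'M[R[i]]_(NR, NS)) (Q : 'M[R[i]]_NS) : 'M[R[i]]_NR :=
  H *m Q *m H^t* + (sR2%:C)%:M.

(* For Q >= 0 both determinants are positive reals, hence so is their ratio;
   [Re] is only a change of type. *)
Definition log_det_ratio (R : realType) (NS NR ND : nat) (sR2 sD2 : R)
    (G : 'M[R[i]]_(ND, NR)) (A : 'M[R[i]]_NR)
    (H : 'M[R[i]]_(NR, NS)) (Q : 'M[R[i]]_NS) : R :=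
  ln (complex.Re
    (\det ((sD2%:C)%:M + G *m A *m rx_cov sR2 H Q *m A^t* *m G^t*) /
     \det ((sD2%:C)%:M + sR2%:C *: (G *m A *m A^t* *m G^t*)))).

(* The expectations below are finite when H is a [channel] driven by a
   Gaussian Z and Q >= 0, so that [fine] is only a change of type. *)
Definition rate (d : measure_display) (T : measurableType d) (R : realType)
    (P : probability T R) (NS NR ND : nat) (sR2 sD2 : R)
    (G : 'M[R[i]]_(ND, NR)) (H : T -> 'M[R[i]]_(NR, NS))
    (A : 'M[R[i]]_NR) (Q : 'M[R[i]]_NS) : R :=
  fine 'E_P[fun w => log_det_ratio sR2 sD2 G A (H w) Q].

Definition relay_power (d : measure_display) (T : measurableType d)
    (R : realType) (P : probability T R) (NS NR : nat) (sR2 : R)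
    (H : T -> 'M[R[i]]_(NR, NS)) (A : 'M[R[i]]_NR) (Q : 'M[R[i]]_NS) : R :=
  fine 'E_P[fun w => complex.Re (\tr (A *m rx_cov sR2 (H w) Q *m A^t*))].

Definition source_power (R : realType) (NS : nat) (Q : 'M[R[i]]_NS) : R :=
  complex.Re (\tr Q).

Definition energy_efficiency (d : measure_display) (T : measurableType d)
    (R : realType) (P : probability T R) (NS NR ND : nat) (sR2 sD2 Pc : R)
    (G : 'M[R[i]]_(ND, NR)) (H : T -> 'M[R[i]]_(NR, NS))
    (A : 'M[R[i]]_NR) (Q : 'M[R[i]]_NS) : R :=
  rate P sR2 sD2 G H A Q / (relay_power P sR2 H A Q + source_power Q + Pc).

Definition feasible (d : measure_display) (T : measurableType d)
    (R : realType) (P : probability T R) (NS NR ND : nat)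
    (sR2 sD2 PSmax PRmax RSmin : R)
    (G : 'M[R[i]]_(ND, NR)) (H : T -> 'M[R[i]]_(NR, NS))
    (A : 'M[R[i]]_NR) (Q : 'M[R[i]]_NS) : Prop :=
  [/\ relay_power P sR2 H A Q <= PRmax,
      source_power Q <= PSmax,
      psd Q &
      RSmin <= rate P sR2 sD2 G H A Q].

(* Q maximizes the energy efficiency for the given A.  If (Q, A) is optimal
   for the joint problem, then in particular Q is optimal for A. *)
Definition optimal_for (d : measure_display) (T : measurableType d)
    (R : realType) (P : probability T R) (NS NR ND : nat)
    (sR2 sD2 Pc PSmax PRmax RSmin : R)
    (G : 'M[R[i]]_(ND, NR)) (H : T -> 'M[R[i]]_(NR, NS))
    (A : 'M[R[i]]_NR) (Q : 'M[R[i]]_NS) : Prop :=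
  feasible P sR2 sD2 PSmax PRmax RSmin G H A Q /\
  forall Q' : 'M[R[i]]_NS,
    feasible P sR2 sD2 PSmax PRmax RSmin G H A Q' ->
    energy_efficiency P sR2 sD2 Pc G H A Q' <=
    energy_efficiency P sR2 sD2 Pc G H A Q.

(* The equality U_Q = U, for some eigenvalue decomposition
   Q = U_Q diag(l_Q) U_Q^H: decompositions are not unique.  The entries of l_Q
   come in the order of the columns of U and need not be decreasing, even when
   U lists the eigenvectors of R_t by decreasing eigenvalue: for nonsingular
   R_t and GA R_r^(1/2) <> 0, under the relay power constraint alone the rate
   is maximized by an l_Q proportional to the inverses of the eigenvalues of
   R_t. *)
Definition has_eigenvectors (R : realType) (NS : nat)
    (U Q : 'M[R[i]]_NS) : Prop :=
  exists (UQ : 'M[R[i]]_NS) (lQ : 'rV[R]_NS), evd UQ lQ Q /\ UQ = U.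

(* Main.v *)
(* Write Q = Ut W Ut^H. Each entry of W that couples the index i to the others
   is killed by averaging W with its conjugate under the sign change of
   coordinate i. The sign change amounts to right multiplication of Z by the
   reflection 1 - 2 u u^H, u the i-th column of Ut, which preserves the law of Z;
   hence both points have the same rate, relay power and trace, and by concavity
   of log det the average is at least as good. Reducing W to diagonal form in
   this way, an optimum exists by compactness. If W is optimal with positive
   rate, then W vanishes on the kernel of R_t (erasing that part costs no rate
   and saves power), and elsewhere it has no off-diagonal entry: otherwise strict
   concavity on an event of positive probability makes the average strictly
   better. *)

Require Import Defs.
From HB Require Import structures.
From mathcomp Require Import all_boot all_order all_algebra.
From mathcomp Require Import sesquilinear spectral complex.
From mathcomp Require Import all_classical all_reals all_analysis.
From mathcomp Require Import measurable_realfun ring lra.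

Set Implicit Arguments.
Unset Strict Implicit.
Unset Printing Implicit Defensive.

Import Order.TTheory GRing.Theory Num.Theory numFieldNormedType.Exports.

Local Open Scope classical_set_scope.
Local Open Scope ring_scope.
Local Open Scope complex_scope.
Local Open Scope sesquilinear_scope.

(** * Log-determinant of positive definite matrices *)

Section positive_matrices.
Context {R : realType}.
Local Notation C := R[i].

(** The main analytic work is the invariance of the law of [Z] under [Z -> Z (I - 2 u u^H)].
    Independence describes the law on rectangles only, and a reflection does not map rectangles to
    rectangles. In real coordinates, the complex reflection of one row is a product of two real
    Householder reflections; planar rotations conjugate each of these to a sign change of one
    coordinate; and a planar rotation is a product of three shears, which preserve Lebesgue measure,
    while the Gaussian density is radial. The log-determinant lemmas carry a margin [X - s I >= 0],
    where [s] becomes the noise variance at the destination. It makes [lndet] Lipschitz for the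
    Loewner order, so that integrability and continuity of the mean gain follow from order bounds,
    with no limit taken under the integral. All inequalities on [lndet], with their equality cases,
    come from [ln x <= x - 1] applied to eigenvalues. *)

Definition lndet n (X : 'M[C]_n) : R := ln (complex.Re (\det X)).

Definition pd n (X : 'M[C]_n) : Prop :=
  X \is hermsymmx /\ forall x : 'cV[C]_n, x != 0 -> 0 < (x^t* *m X *m x) 0 0.

Lemma tcmxM m n p (A : 'M[C]_(m, n)) (B : 'M[C]_(n, p)) :
  (A *m B)^t* = B^t* *m A^t*.
Proof. by rewrite trmx_mul map_mxM. Qed.

Lemma tcmxD m n (A B : 'M[C]_(m, n)) : (A + B)^t* = A^t* + B^t*.
Proof. by rewrite linearD map_mxD. Qed.

Lemma tcmxZ m n (c : R) (A : 'M[C]_(m, n)) : (c%:C *: A)^t* = c%:C *: A^t*.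
Proof.
apply/matrixP => i j; rewrite !mxE rmorphM/=; congr (_ * _).
by apply/eqP; rewrite eq_complex/= oppr0 !eqxx.
Qed.

Lemma tcmxZc m n (c : C) (A : 'M[C]_(m, n)) : (c *: A)^t* = Num.conj c *: A^t*.
Proof. by apply/matrixP => i j; rewrite !mxE rmorphM. Qed.

Lemma tcmx_scalar n (c : R) : ((c%:C)%:M : 'M[C]_n)^t* = (c%:C)%:M.
Proof. by rewrite -scalemx1 tcmxZ trmx1 map_mx1. Qed.

Lemma hermP n (X : 'M[C]_n) : X \is hermsymmx <-> X^t* = X.
Proof.
split; first by move/is_hermitianmxP; rewrite expr0 scale1r.
by move=> h; apply/is_hermitianmxP; rewrite expr0 scale1r.
Qed.

Lemma sqnormE n (x : 'cV[C]_n) : (x^t* *m x) 0 0 = \sum_i `|x i 0| ^+ 2.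
Proof. by rewrite mxE; apply: eq_bigr => i _; rewrite !mxE normCKC. Qed.

Lemma sqnorm_ge0 n (x : 'cV[C]_n) : 0 <= (x^t* *m x) 0 0.
Proof. by rewrite sqnormE sumr_ge0// => i _; rewrite exprn_ge0. Qed.

Lemma sqnorm_gt0 n (x : 'cV[C]_n) : x != 0 -> 0 < (x^t* *m x) 0 0.
Proof.
move=> x0; rewrite lt_neqAle sqnorm_ge0 andbT eq_sym sqnormE; apply: contra x0.
rewrite psumr_eq0 => [/allP h|i _]; last by rewrite exprn_ge0.
apply/eqP/matrixP => i j; rewrite ord1 mxE.
by have := h i (mem_index_enum _); rewrite expf_eq0/= normr_eq0 => /eqP.
Qed.

Lemma psd_congr m n (D : 'M[C]_(m, n)) (Q : 'M[C]_n) :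
  psd Q -> psd (D *m Q *m D^t*).
Proof.
move=> [/hermP hQ pQ]; split.
  by apply/hermP; rewrite !tcmxM trmxCK hQ mulmxA.
by move=> x; have := pQ (D^t* *m x); rewrite tcmxM trmxCK !mulmxA.
Qed.

Lemma psdD n (Q K : 'M[C]_n) : psd Q -> psd K -> psd (Q + K).
Proof.
move=> [/hermP hQ pQ] [/hermP hK pK]; split; first by apply/hermP; rewrite tcmxD hQ hK.
by move=> x; rewrite mulmxDr mulmxDl mxE addr_ge0.
Qed.

Lemma psdZ n (c : R) (Q : 'M[C]_n) : 0 <= c -> psd Q -> psd (c%:C *: Q).
Proof.
move=> c0 [/hermP hQ pQ]; split; first by apply/hermP; rewrite tcmxZ hQ.
by move=> x; rewrite -scalemxAr -scalemxAl mxE mulr_ge0// lecR.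
Qed.

Lemma psd1 n : psd (1%:M : 'M[C]_n).
Proof.
split; first by apply/hermP; rewrite trmx1 map_mx1.
by move=> x; rewrite mulmx1 sqnorm_ge0.
Qed.

Lemma psd_gram m n (D : 'M[C]_(m, n)) : psd (D *m D^t*).
Proof. by have := psd_congr D (psd1 n); rewrite mulmx1. Qed.

Lemma psd_scalar n (c : R) : 0 <= c -> psd ((c%:C)%:M : 'M[C]_n).
Proof. by move=> c0; rewrite -scalemx1; apply: psdZ => //; apply: psd1. Qed.

Lemma pd_scalar n (c : R) : 0 < c -> pd ((c%:C)%:M : 'M[C]_n).
Proof.
move=> c0; split; first by apply/hermP; rewrite tcmx_scalar.
by move=> x x0; rewrite mul_mx_scalar -scalemxAl mxE mulr_gt0 ?ltcR// sqnorm_gt0.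
Qed.

Lemma pdD n (X K : 'M[C]_n) : pd X -> psd K -> pd (X + K).
Proof.
move=> [/hermP hQ pQ] [/hermP hK pK]; split; first by apply/hermP; rewrite tcmxD hQ hK.
by move=> x x0; rewrite mulmxDr mulmxDl mxE ltr_wpDr// pQ.
Qed.

Lemma formE n (X : 'M[C]_n) i :
  X i i = ((delta_mx i 0 : 'cV_n)^t* *m X *m (delta_mx i 0 : 'cV_n)) 0 0.
Proof.
by rewrite -colE mxE trmx_delta map_delta_mx -rowE mxE.
Qed.

Lemma psd_diag_ge0 n (Q : 'M[C]_n) i : psd Q -> 0 <= Q i i.
Proof. by case=> _ pQ; rewrite formE. Qed.

Lemma mxtrace_psd_ge0 n (Q : 'M[C]_n) : psd Q -> 0 <= \tr Q.
Proof. by move=> pQ; rewrite sumr_ge0// => i _; apply: psd_diag_ge0. Qed.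

Lemma ge0_ReK (z : C) : 0 <= z -> (complex.Re z)%:C = z.
Proof. by move=> /ger0_Im; case: z => a b /= ->. Qed.

Lemma real_decompose n (d : 'rV[C]_n) (s : R) : (forall i, s%:C <= d 0 i) ->
  exists2 r : 'rV[R]_n, (forall i, s <= r 0 i) & d = map_mx (real_complex R) r.
Proof.
move=> h; exists (map_mx (@complex.Re R) d).
  by move=> i; have := h i; rewrite lecE mxE => /andP[_].
apply/rowP => i; rewrite !mxE; have := h i; rewrite lecE/=.
by case: (d 0 i) => a b /= /andP[/eqP -> _].
Qed.

(** Conjugating [X - s I >= 0] by the eigenbasis leaves a diagonal matrix with nonnegative entries,
    so the bound passes to the eigenvalues. The margin [s] is 0 when a positive semidefinite matrix
    is merely factored. *)
Lemma herm_spectral n (X : 'M[C]_n) (s : R) : X \is hermsymmx ->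
  psd (X - (s%:C)%:M) ->
  exists P : 'M[C]_n, exists r : 'rV[R]_n,
    [/\ P *m P^t* = 1%:M, P^t* *m P = 1%:M, forall i, s <= r 0 i &
        X = P^t* *m diagC r *m P].
Proof.
move=> hX psX; have uP := spectral_unitarymx X.
have PPt : spectralmx X *m (spectralmx X)^t* = 1%:M by apply/unitarymxP.
have PtP : (spectralmx X)^t* *m spectralmx X = 1%:M.
  by apply/mulmx1C.
have XE : X = (spectralmx X)^t* *m diag_mx (spectral_diag X) *m spectralmx X.
  rewrite -invmx_unitary//; apply/orthomx_spectralP; exact: hermitian_normalmx.
have dge i : s%:C <= spectral_diag X 0 i.
  have := psd_diag_ge0 i (psd_congr (spectralmx X) psX).
  have PXP : spectralmx X *m X *m (spectralmx X)^t* = diag_mx (spectral_diag X).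
    by rewrite {2}XE !mulmxA PPt mul1mx -mulmxA PPt mulmx1.
  rewrite mulmxBr mulmxBl PXP mul_mx_scalar -scalemxAl PPt scalemx1.
  by rewrite !mxE eqxx !mulr1n subr_ge0.
have [r rs dE] := real_decompose dge.
exists (spectralmx X), r; rewrite /diagC -dE.
split; [exact: PPt | exact: PtP | exact: rs | exact: XE].
Qed.

Lemma diagC_mul n (l l' : 'rV[R]_n) :
  diagC l *m diagC l' = diagC (\row_i (l 0 i * l' 0 i)).
Proof.
rewrite /diagC mulmx_diag; congr diag_mx; apply/rowP => i.
by rewrite !mxE rmorphM.
Qed.

Lemma diagC1 n : diagC (const_mx 1 : 'rV[R]_n) = 1%:M.
Proof. by rewrite /diagC map_const_mx rmorph1 diag_const_mx. Qed.

Lemma diagC_tc n (l : 'rV[R]_n) : (diagC l)^t* = diagC l.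
Proof.
rewrite /diagC tr_diag_mx map_diag_mx; congr diag_mx; apply/rowP => i.
by rewrite !mxE; apply/eqP; rewrite eq_complex/= oppr0 !eqxx.
Qed.

Lemma pd_spectral n (X : 'M[C]_n) : pd X ->
  exists P : 'M[C]_n, exists r : 'rV[R]_n,
    [/\ P *m P^t* = 1%:M, P^t* *m P = 1%:M, forall i, 0 < r 0 i &
        X = P^t* *m diagC r *m P].
Proof.
move=> [hX pX].
have : psd (X - (0%:C)%:M).
  rewrite (_ : (0%:C)%:M = 0); last first.
    by apply/matrixP => i j; rewrite !mxE rmorph0 mul0rn.
  rewrite subr0; split => // x; have [->|x0] := eqVneq x 0; last exact/ltW/pX.
  by rewrite mulmx0 mxE.
move/(herm_spectral hX) => [P [r [PP PP' r0 XE]]].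
exists P, r; split => // i.
rewrite lt_neqAle r0 andbT eq_sym; apply/eqP => ri0.
(* [P^H e_i] is the eigenvector for [r 0 i]; a zero eigenvalue would make the quadratic form vanish
   there. *)
have := pX (P^t* *m delta_mx i 0).
rewrite tcmxM trmxCK {1}XE !mulmxA.
rewrite -(mulmxA _ P (P^t*)) PP mulmx1 -(mulmxA _ P (P^t*)) PP mulmx1.
rewrite -formE !mxE eqxx mulr1n ri0 ltxx.
have : P^t* *m delta_mx i 0 != 0 :> 'cV_n.
  apply/eqP => /(congr1 (mulmx P)); rewrite mulmxA PP mul1mx mulmx0.
  by move=> /matrixP/(_ i 0); rewrite !mxE !eqxx => /eqP; rewrite oner_eq0.
by move=> h /(_ h).
Qed.

Lemma det_diagC n (r : 'rV[R]_n) : \det (diagC r) = (\prod_i r 0 i)%:C.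
Proof.
by rewrite /diagC det_diag rmorph_prod; apply: eq_bigr => i _; rewrite mxE.
Qed.

Lemma pd_det_gt0 n (X : 'M[C]_n) : pd X -> 0 < \det X.
Proof.
move=> /pd_spectral[P [r [PP PP' r0 ->]]].
rewrite !det_mulmx mulrAC -det_mulmx PP' det1 mul1r det_diagC ltcR.
by apply: prodr_gt0 => i _.
Qed.

Lemma ln_le_sub1 (x : R) : 0 < x -> ln x <= x - 1.
Proof. by move=> x0; have := expR_ge1Dx (ln x); rewrite lnK ?posrE//; lra. Qed.

Lemma ln_eq_sub1 (x : R) : 0 < x -> ln x = x - 1 -> x = 1.
Proof.
move=> x0 h; have [lnx0|/expR_gt1Dx] := eqVneq (ln x) 0.
  by move: h; rewrite lnx0; lra.
by rewrite lnK ?posrE// h; lra.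
Qed.

Lemma ln_prod n (r : 'I_n -> R) : (forall i, 0 < r i) ->
  ln (\prod_i r i) = \sum_i ln (r i).
Proof.
move=> r0; elim: n r r0 => [|n IH] r r0; first by rewrite !big_ord0 ln1.
by rewrite !big_ord_recl lnM ?IH// posrE// prodr_gt0.
Qed.

(** Sum [ln r <= r - 1] over the eigenvalues. Equality of the sums forces equality in every term,
    hence every eigenvalue to be 1; strict concavity of the log-determinant originates here. *)
Lemma lndet_trace n (W : 'M[C]_n) : pd W ->
  lndet W <= complex.Re (\tr W) - n%:R /\
  (lndet W = complex.Re (\tr W) - n%:R -> W = 1%:M).
Proof.
move=> /pd_spectral[P [r [PP PP' r0 ->]]].
have -> : \tr (P^t* *m diagC r *m P) = (\sum_i r 0 i)%:C.
  rewrite mxtrace_mulC mulmxA PP mul1mx mxtrace_diag rmorph_sum.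
  by apply: eq_bigr => i _; rewrite mxE.
have -> : lndet (P^t* *m diagC r *m P) = \sum_i ln (r 0 i).
  rewrite /lndet !det_mulmx mulrAC -det_mulmx PP' det1 mul1r det_diagC /=.
  by rewrite ln_prod.
have -> : complex.Re (\sum_i r 0 i)%:C - n%:R = \sum_i (r 0 i - 1).
  by rewrite sumrB /= big_const_ord iter_addr_0.
split; first by apply: ler_sum => i _; apply: ln_le_sub1.
move=> /eqP h.
have {}h : \sum_i (r 0 i - 1 - ln (r 0 i)) == 0.
  by rewrite sumrB subr_eq0 eq_sym.
have -> : r = const_mx 1.
  apply/rowP => i; rewrite mxE; apply: ln_eq_sub1 => //.
  move: h; rewrite psumr_eq0 => [/allP/(_ i (mem_index_enum _))|j _].
    by rewrite subr_eq0 => /eqP.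
  by rewrite subr_ge0 ln_le_sub1.
by rewrite diagC1 mulmx1.
Qed.

Lemma ge_scalar_pd n (X : 'M[C]_n) (s : R) :
  0 < s -> psd (X - (s%:C)%:M) -> pd X.
Proof. by move=> s0 /(pdD (pd_scalar n s0)); rewrite addrC subrK. Qed.

Lemma ge_scalarD n (X K : 'M[C]_n) (s : R) :
  psd (X - (s%:C)%:M) -> psd K -> psd (X + K - (s%:C)%:M).
Proof. by move=> pX pK; rewrite addrAC; exact: (psdD pX pK). Qed.

(** Take [M = r^(-1/2) P] from the spectral form of [X], so that [M^H M = X^-1]. The trace bound
    expresses that the eigenvalues of [X^-1] are at most [1/s]. *)
Lemma pd_whiten n (X : 'M[C]_n) (s : R) : 0 < s -> psd (X - (s%:C)%:M) ->
  exists M : 'M[C]_n,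
    [/\ M \in unitmx, M *m X *m M^t* = 1%:M &
        forall K : 'M[C]_n, psd K ->
          complex.Re (\tr (M *m K *m M^t*)) <= complex.Re (\tr K) / s].
Proof.
move=> s0 psX; have [hX _] := ge_scalar_pd s0 psX.
have [P [r [PP PP' rs XE]]] := herm_spectral hX psX.
have r0 i : 0 < r 0 i by apply: lt_le_trans (rs i).
pose q : 'rV[R]_n := \row_i (Num.sqrt (r 0 i))^-1.
have Mt : (diagC q *m P)^t* = P^t* *m diagC q by rewrite tcmxM diagC_tc.
have qrq : diagC q *m diagC r *m diagC q = 1%:M.
  rewrite !diagC_mul -diagC1; congr diagC; apply/rowP => i; rewrite !mxE.
  by rewrite mulrAC -invfM -expr2 sqr_sqrtr ?ltW// mulVf// gt_eqF.
have MXM : diagC q *m P *m X *m (diagC q *m P)^t* = 1%:M.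
  rewrite Mt XE !mulmxA -(mulmxA _ P (P^t*)) PP mulmx1.
  by rewrite -(mulmxA _ P (P^t*)) PP mulmx1.
exists (diagC q *m P); split.
- by move: MXM; rewrite -mulmxA => /mulmx1_unit[].
- exact: MXM.
move=> K pK; rewrite Mt mulmxA mxtrace_mulC !mulmxA.
have PKP : \tr K = \tr (P *m K *m P^t*).
  by rewrite mxtrace_mulC mulmxA PP' mul1mx.
rewrite diagC_mul -(mulmxA _ P K) -(mulmxA _ (P *m K)) PKP.
move: (psd_congr P pK); move: (P *m K *m P^t*) => L pL.
have LE i : L i i = (complex.Re (L i i))%:C by rewrite ge0_ReK// psd_diag_ge0.
have -> : \tr L = (\sum_i complex.Re (L i i))%:C.
  by rewrite rmorph_sum; apply: eq_bigr => i _.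
have -> : \tr (diagC (\row_i (q 0 i * q 0 i)) *m L) =
    (\sum_i (r 0 i)^-1 * complex.Re (L i i))%:C.
  rewrite rmorph_sum; apply: eq_bigr => i _.
  rewrite /diagC mul_diag_mx !mxE {1}LE -rmorphM -invfM -expr2 sqr_sqrtr//.
  exact: ltW.
rewrite /= mulr_suml; apply: ler_sum => i _; rewrite mulrC ler_wpM2l//.
  by have := psd_diag_ge0 i pL; rewrite LE lecR.
by rewrite lef_pV2 ?posrE.
Qed.

(* Concavity: lndet lies below its tangent at X. Since X^-1 = M^H M, the trace
   below is tr (X^-1 Y). *)
Lemma lndet_tangent n (X : 'M[C]_n) (s : R) : 0 < s -> psd (X - (s%:C)%:M) ->
  exists M : 'M[C]_n,
    [/\ M \in unitmx, M *m X *m M^t* = 1%:M,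
       (forall K : 'M[C]_n, psd K ->
          complex.Re (\tr (M *m K *m M^t*)) <= complex.Re (\tr K) / s) &
        forall Y : 'M[C]_n, pd Y ->
          lndet Y <= lndet X + complex.Re (\tr (M *m Y *m M^t*)) - n%:R /\
          (lndet Y = lndet X + complex.Re (\tr (M *m Y *m M^t*)) - n%:R ->
             Y = X)].
Proof.
move=> s0 psX; have [M [uM MXM MK]] := pd_whiten s0 psX.
exists M; split => // Y pY.
have pW : pd (M *m Y *m M^t*).
  have [/hermP hY Y0] := pY; split.
    by apply/hermP; rewrite !tcmxM trmxCK hY mulmxA.
  move=> x x0; have := Y0 (M^t* *m x); rewrite tcmxM trmxCK !mulmxA; apply.
  apply: contra x0 => /eqP h; apply/eqP.
  have uMt : M^t* \in unitmx by move: MXM => /mulmx1_unit[].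
  by rewrite -(mulKmx uMt x) h mulmx0.
(* Whitening turns [det Y / det X] into the determinant of [M Y M^H], so [lndet_trace] yields the
   tangent inequality; in its equality case [M Y M^H = I = M X M^H], and [M] cancels. *)
have dXY : lndet (M *m Y *m M^t*) = lndet Y - lndet X.
  have pX := ge_scalar_pd s0 psX.
  have dX := pd_det_gt0 pX; have dY := pd_det_gt0 pY.
  have d1 : \det M * \det (M^t*) = (\det X)^-1.
    apply: (mulIf (lt0r_neq0 dX)); rewrite mulVf ?(lt0r_neq0 dX)//.
    by rewrite mulrAC -!det_mulmx MXM det1.
  rewrite /lndet !det_mulmx mulrAC d1.
  rewrite -(ge0_ReK (ltW dX)) -(ge0_ReK (ltW dY)) -fmorphV -rmorphM /=.
  have dX' : 0 < complex.Re (\det X) by move: dX; rewrite ltcE => /andP[].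
  have dY' : 0 < complex.Re (\det Y) by move: dY; rewrite ltcE => /andP[].
  by rewrite lnM ?posrE ?invr_gt0// lnV ?posrE// addrC.
have [h1 h2] := lndet_trace pW.
split; first by move: h1; rewrite dXY; lra.
move=> h; have MYM : M *m Y *m M^t* = M *m X *m M^t*.
  by rewrite MXM; apply: h2; rewrite dXY h; lra.
have uMt : M^t* \in unitmx by move: MXM => /mulmx1_unit[].
by move: MYM => /(can_inj (mulmxK uMt))/(can_inj (mulKmx uM)).
Qed.

Lemma complex_ReD (x y : C) : complex.Re (x + y) = complex.Re x + complex.Re y.
Proof. by case: x; case: y. Qed.

Lemma psd_Retr_ge0 n (K : 'M[C]_n) : psd K -> 0 <= complex.Re (\tr K).
Proof. by move/mxtrace_psd_ge0; rewrite lecE => /andP[]. Qed.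

(** The tangent at [X + K] is evaluated at [X]: its linear term is [n] minus the nonnegative trace
    of the whitened [K]. *)
Lemma lndet_le n (X K : 'M[C]_n) (s : R) : 0 < s -> psd (X - (s%:C)%:M) ->
  psd K -> lndet X <= lndet (X + K).
Proof.
move=> s0 pX pK.
have [M [_ MXM _ /(_ X (ge_scalar_pd s0 pX))[h _]]] :=
  lndet_tangent s0 (ge_scalarD pX pK).
apply: (le_trans h).
have : complex.Re (\tr (M *m (X + K) *m M^t*)) = n%:R.
  by rewrite MXM mxtrace1 -(rmorph_nat (real_complex R)).
rewrite mulmxDr mulmxDl raddfD/= complex_ReD.
move: (psd_Retr_ge0 (psd_congr M pK)); move: (complex.Re _) => b.
by move: (lndet _) (complex.Re _) => a c; lra.
Qed.

(** Here the tangent is taken at [X] and evaluated at [X + K]; the margin [s] bounds the trace of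
    the whitened [K]. *)
Lemma lndetD_le n (X K : 'M[C]_n) (s : R) : 0 < s -> psd (X - (s%:C)%:M) ->
  psd K -> lndet (X + K) <= lndet X + complex.Re (\tr K) / s.
Proof.
move=> s0 pX pK.
have [M [_ MXM MK /(_ _ (ge_scalar_pd s0 (ge_scalarD pX pK)))[h _]]] :=
  lndet_tangent s0 pX.
apply: (le_trans h).
have : complex.Re (\tr (M *m X *m M^t*)) = n%:R.
  by rewrite MXM mxtrace1 -(rmorph_nat (real_complex R)).
rewrite mulmxDr mulmxDl raddfD/= complex_ReD.
move: (MK _ pK); move: (lndet X) (complex.Re _) (complex.Re _ / s).
by move=> a b c + e; move: e; move: (complex.Re _) => e; lra.
Qed.

(** Both [X] and [Y] are compared with the tangent at their midpoint [Z], where the two linear terms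
    add up to [2n]. Equality makes both comparisons tight, so [X = Z = Y]. *)
Lemma lndet_midpoint n (X Y Z : 'M[C]_n) (s : R) : 0 < s ->
  psd (X - (s%:C)%:M) -> psd (Y - (s%:C)%:M) -> X + Y = Z + Z ->
  lndet X + lndet Y <= lndet Z + lndet Z /\
  (lndet X + lndet Y = lndet Z + lndet Z -> X = Y).
Proof.
move=> s0 pX pY XYZ.
have hC : (2^-1)%:C + (2^-1)%:C = 1 :> C.
  by rewrite -rmorphD -[RHS](rmorph1 (real_complex R)); congr _%:C; lra.
have ZE : Z = (2^-1)%:C *: (X + Y).
  by rewrite XYZ scalerDr -scalerDl hC scale1r.
have pZ : psd (Z - (s%:C)%:M).
  have -> : Z - (s%:C)%:M = (2^-1)%:C *: ((X - (s%:C)%:M) + (Y - (s%:C)%:M)).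
    by rewrite addrACA scalerDr -ZE scalerDr -scalerDl hC scale1r.
  by apply: psdZ; [rewrite invr_ge0| exact: psdD].
have [M [_ MXM MK h]] := lndet_tangent s0 pZ.
have [h1 h1'] := h _ (ge_scalar_pd s0 pX).
have [h2 h2'] := h _ (ge_scalar_pd s0 pY).
have : complex.Re (\tr (M *m X *m M^t*)) + complex.Re (\tr (M *m Y *m M^t*)) =
  n%:R + n%:R.
  rewrite -complex_ReD -raddfD -mulmxDl -mulmxDr XYZ mulmxDr mulmxDl MXM.
  by rewrite raddfD/= complex_ReD mxtrace1 -(rmorph_nat (real_complex R)).
move=> tE; move: h1 h1' h2 h2' tE.
move: (lndet X) (lndet Y) (lndet Z) => a b c.
move: (complex.Re _) (complex.Re _) (n%:R) => u v w h1 h1' h2 h2' tE.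
split; first by lra.
by move=> e; rewrite (h1' _) ?(h2' _)//; lra.
Qed.

End positive_matrices.

(** * Rotation invariance of the Gaussian measure on the plane *)

Section gaussian_plane.
Context {R : realType}.
Local Open Scope ereal_scope.
Local Notation mu := (@lebesgue_measure R).
Local Notation RT := (measurableTypeR R).

(** The image measure under the translation agrees with Lebesgue measure on half-open intervals,
    which determine it. *)
Lemma lebesgue_measure_shift (a : R) (A : set R) : measurable A ->
  mu ((fun x : R => x + a)%R @^-1` A) = mu A.
Proof.
move=> mA; have mf : measurable_fun setT (fun x : RT => (x + a)%R : RT).
  exact: measurable_funD.
have := @lebesgue_measure_unique R (pushforward mu (fun x : RT => (x + a)%R : RT)).
move=> /(_ mf) h; symmetry; apply: (h _ _ mA) => {A mA h} /= _ [[b c]] _ <-.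
rewrite /pushforward (_ : _ @^-1` _ = `](b - a)%R, (c - a)%R]%classic); last first.
  by apply/seteqP; split => x /=; rewrite !in_itv/= ltrBlDr lerBrDr.
rewrite !lebesgue_measure_itv/= !lte_fin.
by rewrite ltrD2r -!EFinB; case: ifPn => // _; congr EFin; lra.
Qed.

Definition shearl (t : R) (z : RT * RT) : RT * RT := ((z.1 + t * z.2)%R, z.2).
Definition shearr (t : R) (z : RT * RT) : RT * RT := (z.1, (z.2 + t * z.1)%R).

Lemma measurable_shearl t : measurable_fun setT (shearl t).
Proof.
apply: measurable_fun_pair => //=.
by apply: measurable_funD => //; apply: measurable_funM.
Qed.

Lemma measurable_shearr t : measurable_fun setT (shearr t).
Proof.
apply: measurable_fun_pair => //=.
by apply: measurable_funD => //; apply: measurable_funM.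
Qed.

(** On each vertical slice the shear is a translation. *)
Lemma shearr_invariant t A : measurable A ->
  (mu \x mu) (shearr t @^-1` A) = (mu \x mu) A.
Proof.
move=> mA; rewrite /product_measure1; apply: eq_integral => x _ /=.
rewrite -[RHS](lebesgue_measure_shift (t * x)); last exact: measurable_xsection.
by congr (mu _); apply/seteqP; split => y /=; rewrite /xsection/= !inE.
Qed.

(** Horizontal slices are translated this time, so the product measure is first rewritten with the
    other order of integration. *)
Lemma shearl_invariant t A : measurable A ->
  (mu \x mu) (shearl t @^-1` A) = (mu \x mu) A.
Proof.
move=> mA.
have E B : measurable B -> (mu \x mu) B = (mu \x^ mu) B.
  by move=> mB; apply: product_measure_unique => //= *; rewrite product_measure2E.
rewrite !E//; last by rewrite -[X in measurable X]setTI; apply: measurable_shearl.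
rewrite /product_measure2; apply: eq_integral => x _ /=.
rewrite -[RHS](lebesgue_measure_shift (t * x)); last exact: measurable_ysection.
by congr (mu _); apply/seteqP; split => y /=; rewrite /ysection/= !inE.
Qed.

Definition rotation (c s : R) (z : RT * RT) : RT * RT :=
  ((c * z.1 - s * z.2)%R, (s * z.1 + c * z.2)%R).

Lemma measurable_rotation c s : measurable_fun setT (rotation c s).
Proof.
apply: measurable_fun_pair => //=.
  by apply: measurable_funB; apply: measurable_funM.
by apply: measurable_funD; apply: measurable_funM.
Qed.

(** The factor [(c - 1) / s] is minus the tangent of the half angle: the middle shear has slope [s],
    and the outer slope [t] must satisfy [1 + s t = c]. *)
Lemma rotation_shears c s : (c ^+ 2 + s ^+ 2 = 1 -> s != 0 ->
  rotation c s = shearl ((c - 1) / s) \o shearr s \o shearl ((c - 1) / s))%R.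
Proof.
move=> cs s0; apply/funext => -[x y]; rewrite /rotation /shearl /shearr/=.
have cE : (s ^+ 2 = 1 - c ^+ 2)%R by rewrite -cs; ring.
congr pair; last by field.
transitivity ((s * (c * x - s * y)) / s)%R; first by field.
transitivity (((c - 1) * y + s * x + (c - 1) * (c * y + s * x)) / s)%R; last by field.
by congr (_ / _)%R; rewrite mulrBr (mulrA s s) -expr2 cE; ring.
Qed.

Lemma rotation_invariant c s A : (c ^+ 2 + s ^+ 2 = 1)%R -> (s != 0)%R ->
  measurable A -> (mu \x mu) (rotation c s @^-1` A) = (mu \x mu) A.
Proof.
move=> cs s0 mA; rewrite rotation_shears//.
have ml B t : measurable B -> measurable (shearl t @^-1` B).
  by move=> mB; rewrite -[X in measurable X]setTI; apply: measurable_shearl.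
have mr B t : measurable B -> measurable (shearr t @^-1` B).
  by move=> mB; rewrite -[X in measurable X]setTI; apply: measurable_shearr.
rewrite !comp_preimage shearl_invariant; last by apply: mr; apply: ml.
by rewrite shearr_invariant ?shearl_invariant//; apply: ml.
Qed.

(** The Radon-Nikodym derivative of the Gaussian measure has the same integrals as [normal_pdf] over
    measurable sets, so the two densities agree almost everywhere. *)
Lemma ge0_integral_normal_prob (m sd : R) (f : R -> \bar R) :
  measurable_fun [set: R] f -> (forall x, 0 <= f x) ->
  \int[normal_prob m sd]_x f x = \int[mu]_x (f x * (normal_pdf m sd x)%:E).
Proof.
move=> mf f0.
have dom := normal_prob_dominates m sd.
rewrite -(Radon_Nikodym_SigmaFinite.change_of_variables dom)//.
apply: ae_eq_integral => //.
- apply: emeasurable_funM => //; apply: (measurable_int mu).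
  exact: Radon_Nikodym_SigmaFinite.f_integrable.
- apply: emeasurable_funM => //; apply/measurableT_comp => //.
  exact: measurable_normal_pdf.
- apply: ae_eqe_mul2l => /=.
  apply: integral_ae_eq => //=.
  + exact: Radon_Nikodym_SigmaFinite.f_integrable.
  + by apply/measurableT_comp => //; exact: measurable_normal_pdf.
  + by move=> E _ mE; rewrite -Radon_Nikodym_SigmaFinite.f_integral.
Qed.

Definition pdf2 (sd : R) (z : RT * RT) : \bar R :=
  (normal_pdf 0 sd z.1 * normal_pdf 0 sd z.2)%:E.

Lemma measurable_pdf2 sd : measurable_fun setT (pdf2 sd).
Proof.
apply/measurable_EFinP; apply: measurable_funM => /=.
  exact: (measurableT_comp (measurable_normal_pdf 0 sd) measurable_fst).
exact: (measurableT_comp (measurable_normal_pdf 0 sd) measurable_snd).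
Qed.

Lemma pdf2_ge0 sd z : 0 <= pdf2 sd z.
Proof. by rewrite lee_fin mulr_ge0// normal_pdf_ge0. Qed.

Lemma normal_prodE (sd : R) (A : set (RT * RT)) : measurable A ->
  (normal_prob 0 sd \x normal_prob 0 sd) A = \int[mu \x mu]_(z in A) pdf2 sd z.
Proof.
move=> mA; rewrite [LHS]/product_measure1.
rewrite ge0_integral_normal_prob//; last exact: measurable_fun_xsection.
rewrite [RHS]integral_mkcond.
rewrite fubini_tonelli1//=; last 2 first.
- apply/(measurable_restrict _ _ _) => //; apply: measurable_funTS.
  exact: measurable_pdf2.
- by move=> z; rewrite /patch; case: ifP => // _; exact: pdf2_ge0.
apply: eq_integral => x _; rewrite /normal_prob/= muleC.
rewrite -ge0_integralZl//; last 4 first.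
- exact: measurable_xsection.
- apply: measurable_funTS; apply/measurable_EFinP; exact: measurable_normal_pdf.
- by move=> y _; rewrite lee_fin normal_pdf_ge0.
- by rewrite lee_fin normal_pdf_ge0.
rewrite integral_mkcond /fubini_F; apply: eq_integral => y _.
by rewrite /patch mem_xsection; case: ifP => //; rewrite -EFinM.
Qed.

(** The joint density depends on [x^2 + y^2] only, which the rotation preserves, and so does the
    rotation preserve Lebesgue measure. *)
Lemma normal_rotation_invariant (sd c s : R) (A : set (RT * RT)) :
  (c ^+ 2 + s ^+ 2 = 1)%R -> (s != 0)%R -> sd != 0%R -> measurable A ->
  (normal_prob 0 sd \x normal_prob 0 sd) (rotation c s @^-1` A) =
  (normal_prob 0 sd \x normal_prob 0 sd) A.
Proof.
move=> cs s0 sd0 mA.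
have mrA : measurable (rotation c s @^-1` A).
  by rewrite -[X in measurable X]setTI; apply: measurable_rotation.
rewrite !normal_prodE//.
have pE z : pdf2 sd z = pdf2 sd (rotation c s z).
  rewrite /pdf2 /= !normal_pdfE//; congr EFin.
  rewrite mulrACA [RHS]mulrACA; congr *%R; rewrite /normal_fun -!expRD.
  congr expR; rewrite !subr0 -!mulrDl; congr (_ / _)%R.
  move: z => [x y] /=; rewrite -[LHS]mul1r -cs; ring.
have mp : measurable_fun A (pdf2 sd).
  by apply: measurable_funTS; exact: measurable_pdf2.
have p0 : {in A, forall z, 0 <= pdf2 sd z} by move=> z _; exact: pdf2_ge0.
have e := @ge0_integral_pushforward _ _ _ _ R _ (measurable_rotation c s) (mu \x mu)
  A _ mA mp p0.
transitivity (\int[mu \x mu]_(z in rotation c s @^-1` A) (pdf2 sd \o rotation c s) z).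
  by apply: eq_integral => x _; exact: pE.
rewrite -e; apply: eq_measure_integral; first exact: measurable_rotation.
by move=> ? B mB _; exact: rotation_invariant.
Qed.

Lemma normal_opp_invariant (sd : R) (A : set R) : sd != 0%R -> measurable A ->
  normal_prob 0 sd (-%R @^-1` A) = normal_prob 0 sd A.
Proof.
move=> sd0 mA; rewrite /normal_prob.
have mN : measurable_fun setT (-%R : RT -> RT) by exact: oppr_measurable.
have pE x : (normal_pdf 0 sd x)%:E = (normal_pdf 0 sd (- x))%:E.
  by rewrite !normal_pdfE// /normal_fun !subr0 sqrrN.
pose p := fun x : RT => (normal_pdf 0 sd x)%:E.
have mp : measurable_fun A p.
  by apply: measurable_funTS; apply/measurable_EFinP; exact: measurable_normal_pdf.
have p0 : {in A, forall y, 0 <= p y} by move=> z _; rewrite lee_fin normal_pdf_ge0.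
have e := @ge0_integral_pushforward _ _ RT RT R _ mN mu A p mA mp p0.
transitivity (\int[mu]_(x in -%R @^-1` A) (p \o -%R) x).
  by apply: eq_integral => x _; exact: pE.
rewrite -e; apply: eq_measure_integral => B mB _; exact: lebesgue_measureN.
Qed.

End gaussian_plane.

(** * Reflections of Gaussian families *)

(** A separate name for the function space, on which the product sigma-algebra generated by
    [rectangles] is placed; the joint law of a family is a measure there. *)
Definition coords (I : finType) (R : realType) : Type := I -> R.
HB.instance Definition _ I R := gen_eqMixin (coords I R).
HB.instance Definition _ I R := gen_choiceMixin (coords I R).
HB.instance Definition _ I (R : realType) :=
  isPointed.Build (coords I R) (fun=> 0 : R).

Definition rectangles (I : finType) (R : realType) : set (set (coords I R)) :=
  [set A | exists2 B : I -> set R,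
    (forall i, measurable (B i)) & A = [set x | forall i, B i (x i)]].

Notation coordType I R := (g_sigma_algebraType (@rectangles I R)).

Section gaussian_families.
Context {d : measure_display} {T : measurableType d} {R : realType}.
Variable P : probability T R.
Variable sd : R.
Hypothesis sd0 : sd != 0.
Variable I : finType.
Implicit Types (X Y : T -> I -> R) (B : I -> set R).
Local Notation RT := (measurableTypeR R).

(** Independent centred real Gaussians of standard deviation [sd]. Independence and marginals are
    one formula, since any [B i] may be the whole line. *)
Definition gaussian_family X :=
  (forall i, measurable_fun [set: T] (fun w => X w i : RT)) /\
  forall B, (forall i, measurable (B i)) ->
    P [set w | forall i, B i (X w i)] = (\prod_i normal_prob 0%R sd (B i))%E.

Definition flip (a : I) (x : I -> R) (i : I) : R := if i == a then - x i else x i.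

Definition planar_rotation (a b : I) (c s : R) (x : I -> R) (i : I) : R :=
  if i == a then c * x a - s * x b
  else if i == b then s * x a + c * x b else x i.

Lemma gaussian_flip a X : gaussian_family X -> gaussian_family (flip a \o X).
Proof.
move=> [mX gX]; split.
  move=> i; rewrite /flip/=; case: eqP => _; last exact: mX.
  exact: (measurable_funN (mX i)).
move=> B mB.
pose B' i := if i == a then -%R @^-1` B i else B i.
have mB' i : measurable (B' i).
  rewrite /B'; case: eqP => _ //.
  by rewrite -[X in measurable X]setTI; apply: oppr_measurable.
rewrite [X in P X](_ : _ = [set w | forall i, B' i (X w i)]); last first.
  apply/seteqP; split => w /= h i; have := h i; rewrite /B' /flip;
  by case: eqP.
rewrite gX//; apply: eq_bigr => i _; rewrite /B'; case: eqP => // _.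
exact: normal_opp_invariant.
Qed.

Lemma measurable_gaussian_rect X B : gaussian_family X ->
  (forall i, measurable (B i)) -> measurable [set w | forall i, B i (X w i)].
Proof.
move=> [mX _] mB.
rewrite (_ : [set w | _] = \bigcap_(i in [set: I]) ((fun w => X w i) @^-1` B i)).
  apply: fin_bigcap_measurable; first exact: finite_finset.
  by move=> i _; rewrite -[_ @^-1` _]setTI; exact: (mX i measurableT _ (mB i)).
by apply/seteqP; split => w /= h i; [move=> _; apply: h | apply: (h i)].
Qed.

(** The preimage of a rectangle under the rotation is not a rectangle. So restrict [P] to the event
    [D] on the other coordinates: the image of this measure under [(X a, X b)] agrees on rectangles
    with the planar Gaussian measure scaled by the probability [r] of [D], hence on all measurable
    sets, and planar invariance applies. *)
Lemma gaussian_planar_rotation a b c s X : a != b -> c ^+ 2 + s ^+ 2 = 1 -> s != 0 ->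
  gaussian_family X -> gaussian_family (planar_rotation a b c s \o X).
Proof.
move=> ab cs s0 gX0; have [mX gX] := gX0; split.
  move=> i; rewrite /planar_rotation/=; case: eqP => _; last case: eqP => _.
  - by apply: measurable_funB; apply: measurable_funM => //; exact: mX.
  - by apply: measurable_funD; apply: measurable_funM => //; exact: mX.
  - exact: mX.
move=> B mB.
(* [B0] releases the constraints on [a] and [b], so that [D] concerns the other coordinates only. *)
pose B0 i := if (i == a) || (i == b) then [set: R] else B i.
have mB0 i : measurable (B0 i) by rewrite /B0; case: ifP.
pose D := [set w | forall i, B0 i (X w i)].
have mD : measurable D by exact: measurable_gaussian_rect.
pose Xab w : RT * RT := (X w a, X w b).
have mXab : measurable_fun setT Xab by apply: measurable_fun_pair; exact: mX.
pose r := (\prod_(i | (i != a) && (i != b)) normal_prob 0%R sd (B i))%E.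
have r_fin : r \is a fin_num.
  apply: prode_fin_num => i _.
  by apply: (fin_num_measure (normal_prob 0%R sd)); exact: mB.
have r_ge0 : (0 <= r)%E by apply: prode_ge0 => i _.
have rE : (NngNum (fine_ge0 r_ge0))%:num%:E = r by rewrite /= fineK.
pose m2 := mscale (NngNum (fine_ge0 r_ge0))
  (normal_prob 0%R sd \x normal_prob 0%R sd)%E.
pose m1 := pushforward (mrestr P mD) Xab.
have ba : (b == a) = false by rewrite eq_sym (negbTE ab).
have prodE C1 C2 :
  (\prod_i normal_prob 0%R sd (if i == a then C1 else if i == b then C2 else B0 i) =
   r * (normal_prob 0%R sd C1 * normal_prob 0%R sd C2))%E.
  rewrite (bigD1 a)//= eqxx (bigD1 b) ?ba//= ?ba eqxx muleA.
  rewrite muleC; congr (_ * _)%E; apply: eq_bigr => i /andP[ia ib].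
  by rewrite /B0 (negbTE ia) (negbTE ib).
have m2E C : m2 C = (r * (normal_prob 0%R sd \x normal_prob 0%R sd) C)%E.
  by rewrite -rE.
have m12 C : measurable C -> m1 C = m2 C.
  pose G : set (set (RT * RT)) := [set A `*` B | A in measurable & B in measurable].
  apply: (measure_unique G (fun _ => setT)) => //.
  - exact: measurable_prod_measurableType.
  - move=> _ _ [A1 mA1 [A2 mA2 <-]] [A3 mA3 [A4 mA4 <-]].
    rewrite -setXI; exists (A1 `&` A3); first exact: measurableI.
    by exists (A2 `&` A4) => //; exact: measurableI.
  - by move=> _; exists setT => //; exists setT => //; rewrite setXTT.
  - by rewrite bigcup_const.
  - move=> _ [C1 mC1 [C2 mC2 <-]].
    rewrite [RHS]m2E product_measure1E//= /m1 /pushforward /mrestr.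
    rewrite -prodE -gX; last by move=> i; do 2 case: ifP => // _.
    congr (P _); apply/seteqP; split => w /=.
      move=> [[h1 h2] hD] i; have := hD i; rewrite /B0.
      by case: eqP => [->//|_]; case: eqP => [->//|_].
    move=> h; split; last first.
      move=> i; have := h i; rewrite /B0.
      by case: eqP => [->//|_]; case: eqP => [->//|_].
    by split; [have := h a; rewrite eqxx | have := h b; rewrite ba eqxx].
  - move=> _; apply: (@le_lt_trans _ _ 1%E); last exact: ltry.
    by apply: probability_le1; rewrite preimage_setT setTI.
pose Bab : set (RT * RT) := B a `*` B b.
have mBab : measurable Bab by apply: measurableX; exact: mB.
have mR : measurable (rotation c s @^-1` Bab).
  by rewrite -[X in measurable X]setTI; apply: measurable_rotation.
have e : m1 (rotation c s @^-1` Bab) =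
    (r * (normal_prob 0%R sd (B a) * normal_prob 0%R sd (B b)))%E.
  rewrite m12// m2E normal_rotation_invariant//; congr (_ * _)%E.
  by rewrite product_measure1E//; exact: mB.
rewrite -prodE in e.
transitivity (P ((Xab @^-1` (rotation c s @^-1` Bab)) `&` D)).
  congr (P _); apply/seteqP; split => w /=.
    move=> h; split; last first.
      move=> i; have := h i; rewrite /B0 /planar_rotation.
      by case: eqP => [->//|_]; case: eqP => [->//|_].
    split; first by have := h a; rewrite /planar_rotation eqxx.
    by have := h b; rewrite /planar_rotation ba eqxx.
  move=> [[/= h1 h2] hD] i; have := hD i; rewrite /B0 /planar_rotation.
  by case: eqP => [->//|_]; case: eqP => [->//|_].
rewrite [LHS]e; apply: eq_bigr => i _; rewrite /B0.
by case: eqP => [->//|_]; case: eqP => [->//|_].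
Qed.

Definition dotp (v x : I -> R) := \sum_i v i * x i.

Definition householder (v x : I -> R) (i : I) : R :=
  x i - 2 * dotp v x / dotp v v * v i.

Lemma dotp_planar_rotation a b c s v x : a != b -> c ^+ 2 + s ^+ 2 = 1 ->
  dotp (planar_rotation a b c s v) (planar_rotation a b c s x) = dotp v x.
Proof.
move=> ab cs; have ba : (b == a) = false by rewrite eq_sym (negbTE ab).
rewrite /dotp (bigD1 a)//= (bigD1 b) ?ba//=.
rewrite [RHS](bigD1 a)//= [X in _ = _ + X](bigD1 b) ?ba//= !addrA.
congr (_ + _); last first.
  by apply: eq_bigr => i /andP[ia ib]; rewrite /planar_rotation (negbTE ia) (negbTE ib).
rewrite /planar_rotation ba !eqxx.
by rewrite -[RHS]mul1r -cs; ring.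
Qed.

Lemma planar_rotationK a b c s x i : a != b -> c ^+ 2 + s ^+ 2 = 1 ->
  planar_rotation a b c (- s) (planar_rotation a b c s x) i = x i.
Proof.
move=> ab cs; rewrite {1}/planar_rotation.
have Ea : planar_rotation a b c s x a = c * x a - s * x b.
  by rewrite /planar_rotation eqxx.
have Eb : planar_rotation a b c s x b = s * x a + c * x b.
  by rewrite /planar_rotation eq_sym (negbTE ab) eqxx.
case: eqP => [->|/eqP ia]; first by rewrite Ea Eb -[RHS]mul1r -cs; ring.
case: eqP => [->|/eqP ib]; first by rewrite Ea Eb -[RHS]mul1r -cs; ring.
by rewrite /planar_rotation (negbTE ia) (negbTE ib).
Qed.

Lemma planar_rotation_lin a b c s (k : R) x y :
  planar_rotation a b c s (fun i => x i - k * y i) =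
  (fun i => planar_rotation a b c s x i - k * planar_rotation a b c s y i).
Proof.
apply/funext => i; rewrite /planar_rotation.
by case: ifP => _; [|case: ifP => _]; ring.
Qed.

(* Planar rotations reduce the support of [v] until the reflection is a change
   of sign of one coordinate. *)
Lemma gaussian_householder v X :
  gaussian_family X -> gaussian_family (householder v \o X).
Proof.
have [n le_n] := ubnP #|[pred i | v i != 0]|.
elim: n => // n IH in v X le_n *; move=> gX.
have [v0|/existsNP[a /eqP va]] := pselect (forall i, v i = 0).
  (* When [v] vanishes the subtracted term is a multiple of 0, whatever the quotient by [dotp v v]
     is, and the reflection is the identity. *)
  rewrite (_ : _ \o _ = X)//; apply/funext => w; apply/funext => i /=.
  rewrite /householder v0.
  by rewrite mulr0 subr0.
have [v0|/existsNP[b /not_implyP[ba /eqP vb]]] :=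
    pselect (forall i, i != a -> v i = 0).
  rewrite (_ : _ \o _ = flip a \o X); first exact: gaussian_flip.
  apply/funext => w; apply/funext => i /=; rewrite /householder /flip.
  have dE x : dotp v x = v a * x a.
    by rewrite /dotp (bigD1 a)//= big1 ?addr0// => j ja; rewrite v0 ?mul0r.
  rewrite !dE; case: eqP => [->|/eqP ia]; last by rewrite (v0 i)// mulr0 subr0.
  by field.
have ab : a != b by rewrite eq_sym.
pose r := Num.sqrt (v a ^+ 2 + v b ^+ 2).
have r2 : r ^+ 2 = v a ^+ 2 + v b ^+ 2 by rewrite sqr_sqrtr// addr_ge0// sqr_ge0.
have r0 : r != 0.
  apply/eqP => r0; move: r2; rewrite r0 expr0n/= => /esym/eqP.
  by rewrite paddr_eq0 ?sqr_ge0// !sqrf_eq0 (negbTE va).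
(* The rotation sends [(v a, v b)] to [(r, 0)], which removes [b] from the support and adds nothing,
   as [a] belongs to it already. *)
pose c := v a / r; pose s := - (v b / r).
have cs : c ^+ 2 + s ^+ 2 = 1.
  by rewrite /c /s sqrrN !expr_div_n -mulrDl -r2 divff// sqrf_eq0.
have s0 : s != 0 by rewrite oppr_eq0 mulf_neq0// invr_eq0.
have Ns0 : - s != 0 by rewrite oppr_eq0.
have cNs : c ^+ 2 + (- s) ^+ 2 = 1 by rewrite sqrrN.
pose v' := planar_rotation a b c s v.
have v'b : v' b = 0.
  by rewrite /v' /planar_rotation (negbTE ba) eqxx /s /c; field.
have gY : gaussian_family (planar_rotation a b c s \o X).
  exact: gaussian_planar_rotation.
have gZ : gaussian_family (householder v' \o (planar_rotation a b c s \o X)).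
  apply: IH => //; rewrite -ltnS; apply: leq_trans le_n; rewrite ltnS.
  apply: proper_card; apply/properP; split.
    apply/fintype.subsetP => i; rewrite !inE /v' /planar_rotation.
    by case: (i =P a) => [->|_]; rewrite ?va// ; case: (i =P b) => [->|_]; rewrite ?vb.
  by exists b; rewrite inE ?v'b ?eqxx//; apply/eqP.
(* Rotating back turns the reflection along [v'] into the one along [v], because the rotation is
   linear and preserves [dotp]. *)
have := gaussian_planar_rotation ab cNs Ns0 gZ.
rewrite (_ : _ \o (_ \o _) = householder v \o X)//.
apply/funext => w; apply/funext => i /=.
rewrite /householder /v' !dotp_planar_rotation//.
by rewrite planar_rotation_lin !planar_rotationK.
Qed.

Lemma measurable_coord i :
  measurable_fun [set: coordType I R] (fun x : coordType I R => x i : RT).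
Proof.
move=> _ C mC; rewrite setTI; apply: sub_sigma_algebra.
exists (fun j => if j == i then C else setT); first by move=> j; case: ifP.
apply/seteqP; split => x /= h; last by have := h i; rewrite eqxx.
by move=> j; case: eqP => [->|].
Qed.

Lemma measurable_family X : (forall i, measurable_fun [set: T] (fun w => X w i : RT)) ->
  measurable_fun [set: T] (X : T -> coordType I R).
Proof.
move=> mX; apply: (@measurability _ _ T (coordType I R) setT X (@rectangles I R)) => //.
move=> _ [_ [B mB ->] <-]; rewrite setTI.
rewrite (_ : _ @^-1` _ = \bigcap_(i in [set: I]) ((fun w => X w i) @^-1` B i)).
  apply: fin_bigcap_measurable; first exact: finite_finset.
  by move=> i _; rewrite -[_ @^-1` _]setTI; exact: (mX i measurableT _ (mB i)).
by apply/seteqP; split => w /= h i; [move=> _; apply: h | apply: (h i)].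
Qed.

(** Rectangles are stable under intersection and generate the sigma-algebra, and both laws give them
    the same product. *)
Lemma gaussian_family_law X Y : gaussian_family X -> gaussian_family Y ->
  forall A : set (coordType I R), measurable A -> P (X @^-1` A) = P (Y @^-1` A).
Proof.
move=> [mX gX] [mY gY] A mA.
have mX' := measurable_family mX; have mY' := measurable_family mY.
have uniq_m := @measure_unique _ R (coordType I R) (@rectangles I R) (fun=> setT) erefl.
pose law Y' (mY0 : measurable_fun [set: T] (Y' : T -> coordType I R)) :=
  measure_function_pushforward__canonical__measure_function_Measure P mY0.
refine (uniq_m _ _ _ (law X mX') (law Y mY') _ _ A mA) => //.

- move=> _ _ [B mB ->] [C mC ->]; exists (fun i => B i `&` C i).
    by move=> i; exact: measurableI.
  apply/seteqP; split => x /= => [[h1 h2] i|h]; split => //.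
    by move=> i; have [] := h i.
  by move=> i; have [] := h i.
- by move=> _; exists (fun=> setT) => //; apply/seteqP; split.
- by rewrite bigcup_const.
- by move=> _ [B mB ->]; rewrite /pushforward [LHS]gX// [RHS]gY.
- move=> _; apply: (@le_lt_trans _ _ 1%E); last exact: ltry.
  by apply: probability_le1; rewrite preimage_setT.
Qed.

Lemma gaussian_family_integral X Y (f : coordType I R -> \bar R) :
  gaussian_family X -> gaussian_family Y ->
  measurable_fun setT f -> (forall x, 0 <= f x)%E ->
  (\int[P]_w f (X w) = \int[P]_w f (Y w))%E.
Proof.
move=> gX gY mf f0.
have mX := measurable_family gX.1; have mY := measurable_family gY.1.
have f0' : {in [set: coordType I R], forall x, (0 <= f x)%E} by [].
have eX := @ge0_integral_pushforward _ _ _ (coordType I R) R _ mX P _ f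
  measurableT mf f0'.
have eY := @ge0_integral_pushforward _ _ _ (coordType I R) R _ mY P _ f
  measurableT mf f0'.
rewrite !preimage_setT in eX eY.
rewrite -[LHS]eX -[RHS]eY; apply: eq_measure_integral => A mA _.
exact: gaussian_family_law.
Qed.

End gaussian_families.

(** * Complex Gaussian matrices *)

Section complex_coordinates.
Context {d : measure_display} {T : measurableType d} {R : realType}.
Variable P : probability T R.
Variables (m n : nat).
Local Notation C := R[i].
Local Notation I := ('I_m * 'I_n * bool)%type.
Local Notation RT := (measurableTypeR R).
Local Notation sd := (Num.sqrt (1 / 2 : R)).

Definition mx_of_coords (x : I -> R) : 'M[C]_(m, n) :=
  \matrix_(i, j) (x (i, j, false) +i* x (i, j, true)).

Definition coords_of_mx (M : 'M[C]_(m, n)) (k : I) : R :=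
  if k.2 then complex.Im (M k.1.1 k.1.2) else complex.Re (M k.1.1 k.1.2).

Lemma coords_of_mxK : cancel coords_of_mx mx_of_coords.
Proof.
by move=> M; apply/matrixP => i j; rewrite mxE /coords_of_mx/=; case: (M i j).
Qed.

Lemma sd_neq0 : sd != 0.
Proof. by rewrite gt_eqF// sqrtr_gt0. Qed.

(** Unit complex variance is shared equally between real and imaginary parts, whence the standard
    deviation [sqrt (1/2)]. Independence across entries is assumed; independence of the two parts of
    one entry comes from properness. *)
Lemma iid_gaussian_family (Z : T -> 'M[C]_(m, n)) :
  iid_standard_complex_gaussian P Z ->
  gaussian_family P sd (fun w => coords_of_mx (Z w)).
Proof.
move=> [gZ iZ].
have mZ i j : measurable_fun setT (fun w => reim (Z w i j)) by have [] := gZ i j.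
split.
  move=> [[i j] b]; rewrite /coords_of_mx/=; case: b.
    exact: (measurableT_comp measurable_snd (mZ i j)).
  exact: (measurableT_comp measurable_fst (mZ i j)).
move=> B mB.
pose B2 (k : 'I_m * 'I_n) : set (R * R) := B (k, false) `*` B (k, true).
have mB2 k : measurable (B2 k) by exact: measurableX.
have := iZ [set: 'I_m * 'I_n]%SET B2 mB2.
rewrite (_ : \bigcap_(i in _) _ =
    [set w | forall i, B i (coords_of_mx (Z w) i)]); last first.
  apply/seteqP; split => w /= h.
    move=> [[i j] b]; have [|/=] := h (i, j); first by rewrite /= finset.in_setT.
    by rewrite /coords_of_mx/=; case: b.
  move=> [i j] _; rewrite /B2/=; split.
    by have := h (i, j, false).
  by have := h (i, j, true).
move=> ->.
rewrite (eq_bigl xpredT); last by move=> k; rewrite finset.in_setT.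
transitivity (\prod_(k : 'I_m * 'I_n) \prod_(b : bool) normal_prob 0%R sd (B (k, b)))%E.
  apply: eq_bigr => -[i j] _; rewrite big_bool.
  have [_ ->//] := gZ i j.
  by rewrite product_measure1E; [exact: muleC|exact: mB|exact: mB].
by rewrite pair_big; apply: eq_bigr => -[k b].
Qed.

Lemma dotp_row (k : 'I_m) (f : 'I_n -> bool -> R) (x : I -> R) :
  dotp (fun l : I => if l.1.1 == k then f l.1.2 l.2 else 0) x =
  \sum_j (f j false * x (k, j, false) + f j true * x (k, j, true)).
Proof.
rewrite /dotp; pose F (p : 'I_m * 'I_n) (b : bool) :=
  (if p.1 == k then f p.2 b else 0) * x (p, b).
transitivity (\sum_p \sum_b F p b).
  by rewrite pair_bigA; apply: eq_bigr => -[p b] _.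
transitivity (\sum_i \sum_j \sum_b F (i, j) b).
  by rewrite [RHS]pair_bigA; apply: eq_bigr => -[i j] _.
rewrite (bigD1 k)//= [X in _ + X]big1 ?addr0 => [|i /negbTE ik].
  by apply: eq_bigr => j _; rewrite big_bool /F/= eqxx addrC.
by rewrite big1// => j _; rewrite big1// => b _; rewrite /F/= ik mul0r.
Qed.

Lemma complex_sum (J : finType) (F : J -> C) :
  \sum_j F j = (\sum_j complex.Re (F j)) +i* (\sum_j complex.Im (F j)).
Proof.
apply/eqP; rewrite eq_complex/=; apply/andP; split; apply/eqP.
  by apply: (big_morph (@complex.Re R)) => // -[a b] [a' b'].
by apply: (big_morph (@complex.Im R)) => // -[a b] [a' b'].
Qed.

Lemma gaussian_reflection (X : T -> I -> R) (u : 'cV[C]_n) :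
  (u^t* *m u) 0 0 = 1 -> gaussian_family P sd X ->
  exists2 Y, gaussian_family P sd Y &
    forall w, mx_of_coords (Y w) = mx_of_coords (X w) *m (1%:M - 2%:R *: (u *m u^t*)).
Proof.
move=> u1 gX.
(* Right multiplication acts on each row separately, so the rows are reflected one at a time; [p]
   counts those already done. *)
suff h p : (p <= m)%N -> exists2 Y, gaussian_family P sd Y &
    forall w (i : 'I_m) j, mx_of_coords (Y w) i j =
      (if (i < p)%N then mx_of_coords (X w) *m (1%:M - 2%:R *: (u *m u^t*))
       else mx_of_coords (X w)) i j.
  have [Y gY YE] := h m (leqnn m).
  by exists Y => // w; apply/matrixP => i j; rewrite YE ltn_ord.
elim: p => [_|p IH pm]; first by exists X.
have [Y gY YE] := IH (ltnW pm).
pose k : 'I_m := Ordinal pm.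
(* The complex reflection of row k is the product of the real reflections along
   the conjugate of u and its multiple by i. *)
pose f1 j (b : bool) : R := if b then - complex.Im (u j 0) else complex.Re (u j 0).
pose f2 j (b : bool) : R := if b then complex.Re (u j 0) else complex.Im (u j 0).
pose v1 (l : I) : R := if l.1.1 == k then f1 l.1.2 l.2 else 0.
pose v2 (l : I) : R := if l.1.1 == k then f2 l.1.2 l.2 else 0.
exists (householder v2 \o (householder v1 \o Y)).
  by do 2 apply: (gaussian_householder sd_neq0).
have sq1 : \sum_j (complex.Re (u j 0) ^+ 2 + complex.Im (u j 0) ^+ 2) = 1.
  apply: (@complexI R); rewrite rmorph_sum rmorph1 -u1 sqnormE.
  by apply: eq_bigr => j _; exact: add_Re2_Im2.
have d11 : dotp v1 v1 = 1.
  rewrite dotp_row -sq1; apply: eq_bigr => j _.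
  by rewrite /v1/= eqxx /f1; ring.
have d22 : dotp v2 v2 = 1.
  rewrite dotp_row -sq1; apply: eq_bigr => j _.
  by rewrite /v2/= eqxx /f2; ring.
have d21 : dotp v2 v1 = 0.
  rewrite dotp_row big1// => j _.
  by rewrite /v1/= eqxx /f2 /f1; ring.
move=> w i j; set z := mx_of_coords (X w).
(* Since [v1] and [v2] are orthonormal, the second reflection does not see the first: each subtracts
   twice its own projection of [Y w]. *)
have hE l : householder v2 (householder v1 (Y w)) l =
    Y w l - 2 * dotp v1 (Y w) * v1 l - 2 * dotp v2 (Y w) * v2 l.
  rewrite /householder d11 d22 !divr1; congr (_ - 2 * _ * _).
  have -> : dotp v2 (fun i0 => Y w i0 - 2 * dotp v1 (Y w) * v1 i0) =
      dotp v2 (Y w) - 2 * dotp v1 (Y w) * dotp v2 v1.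
    move: (2 * dotp v1 (Y w)) => c'.
    rewrite /dotp mulr_sumr -sumrB; apply: eq_bigr => l' _.
    by ring.
  by rewrite d21 mulr0 subr0.
rewrite mxE /= !hE.
have [ik|ik] := eqVneq i k; last first.
  rewrite /v1 /v2 /= (negbTE ik) !mulr0 !subr0.
  have := YE w i j; rewrite [in LHS]mxE => ->.
  by rewrite ltnS [in RHS]leq_eqVlt; move: ik; rewrite -val_eqE /= => /negbTE ->.
rewrite ik /= ltnSn.
have Yk j' : Y w (k, j', false) +i* Y w (k, j', true) = z k j'.
  by have := YE w k j'; rewrite /= ltnn [in LHS]mxE.
rewrite mulmxBr mulmx1 -scalemxAr mulmxA.
have -> : (z - 2%:R *: (z *m u *m u^t*)) k j =
    z k j - 2%:R * ((z *m u) k 0 * Num.conj (u j 0)).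
  by rewrite !mxE big_ord_recl big_ord0 addr0 !mxE.
(* The two real projections are the real and imaginary parts of the complex one. *)
have -> : (z *m u) k 0 = dotp v1 (Y w) +i* dotp v2 (Y w).
  rewrite mxE complex_sum !dotp_row; congr Complex; apply: eq_bigr => j' _;
  by rewrite -Yk /f1 /f2; case: (u j' 0) => a b /=; ring.
rewrite /v1 /v2/= eqxx -Yk /f1 /f2; case: (u j 0) => a b.
have -> : (2%:R : C) = 2%:R%:C by rewrite rmorph_nat.
apply/eqP; rewrite eq_complex /=; apply/andP; split; apply/eqP; ring.
Qed.

End complex_coordinates.

(** * Second moments and full support of Gaussian families *)

Section moments.
Context {d : measure_display} {T : measurableType d} {R : realType}.
Variable P : probability T R.
Variable sd : R.
Hypothesis sd0 : sd != 0.
Variable I : finType.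
Local Notation RT := (measurableTypeR R).

Lemma gaussian_marginal (X : T -> I -> R) i (B : set R) :
  gaussian_family P sd X -> measurable B ->
  P ((fun w => X w i) @^-1` B) = normal_prob 0 sd B.
Proof.
move=> [mX gX] mB.
have := gX (fun j => if j == i then B else setT).
rewrite (_ : [set w | _] = (fun w => X w i) @^-1` B); last first.
  apply/seteqP; split => w /= h; first by have := h i; rewrite eqxx.
  by move=> j; case: eqP => [->|].
move=> ->; last by move=> j; case: ifP.
rewrite (bigD1 i)//= eqxx big1 ?mule1// => j /negbTE ->.
exact: probability_setT.
Qed.

(** Split the exponential as [e^(-q) e^(-q)] with [q = x^2 / (4 sd^2)]: one factor absorbs [x^2],
    because [q e^(-q) <= 1]; the other is an unnormalized Gaussian of deviation [sd sqrt 2]. Finite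
    second moments follow by integration. *)
Lemma sqr_normal_pdf_le : exists2 K : R, 0 <= K &
  forall x, x ^+ 2 * normal_pdf 0 sd x <= K * normal_pdf 0 (sd * Num.sqrt 2) x.
Proof.
have s2 : sd * Num.sqrt 2 != 0 by rewrite mulf_neq0// gt_eqF// sqrtr_gt0.
have ps2 := normal_peak_gt0 s2.
exists (4 * sd ^+ 2 * normal_peak sd / normal_peak (sd * Num.sqrt 2)).
  by rewrite divr_ge0 ?normal_peak_ge0// mulr_ge0 ?normal_peak_ge0// mulr_ge0 ?sqr_ge0.
move=> y; rewrite !normal_pdfE//=.
pose q := y ^+ 2 / (4 * sd ^+ 2).
have E1 : normal_fun 0 sd y = expR (- q) * expR (- q).
  by rewrite -expRD /normal_fun /q; congr expR; field.
have E2 : normal_fun 0 (sd * Num.sqrt 2) y = expR (- q).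
  by rewrite /normal_fun /q exprMn sqr_sqrtr//; congr expR; field.
have qE : q * expR (- q) <= 1.
  rewrite expRN ler_pdivrMr ?expR_gt0// mul1r.
  by apply: le_trans (expR_ge1Dx q); rewrite lerDr.
have yE : y ^+ 2 * expR (- q) <= 4 * sd ^+ 2.
  have -> : y ^+ 2 = 4 * sd ^+ 2 * q by rewrite /q; field.
  rewrite -mulrA -[leRHS]mulr1 ler_wpM2l// mulr_ge0 ?sqr_ge0//.
rewrite E1 E2.
have -> : 4 * sd ^+ 2 * normal_peak sd / normal_peak (sd * Num.sqrt 2) *
    (normal_peak (sd * Num.sqrt 2) * expR (- q)) =
    (normal_peak sd * expR (- q)) * (4 * sd ^+ 2).
  by rewrite mulrA divfK ?gt_eqF//; ring.
have -> : y ^+ 2 * (normal_peak sd * (expR (- q) * expR (- q))) =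
    (normal_peak sd * expR (- q)) * (y ^+ 2 * expR (- q)) by ring.
by rewrite ler_wpM2l// mulr_ge0 ?expR_ge0 ?normal_peak_ge0.
Qed.

Lemma gaussian_sqr_integrable (X : T -> I -> R) i : gaussian_family P sd X ->
  P.-integrable setT (fun w => (X w i ^+ 2)%:E).
Proof.
move=> gX; have [mX _] := gX.
have mXi := mX i.
have msq : measurable_fun setT (fun x : RT => (x ^+ 2)%:E).
  by apply/measurable_EFinP; apply: measurable_funX.
have sq0 : {in [set: RT], forall x, (0 <= (x ^+ 2)%:E)%E}.
  by move=> x _; rewrite lee_fin sqr_ge0.
apply/integrableP; split.
  by apply/measurable_EFinP; apply: measurable_funX.
under eq_integral do rewrite gee0_abs ?lee_fin ?sqr_ge0//.
have e := @ge0_integral_pushforward _ _ _ RT R _ mXi P _ _ measurableT msq sq0.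
rewrite preimage_setT in e; rewrite -[X in (X < _)%E]e.
rewrite (eq_measure_integral (normal_prob 0 sd)); last first.
  by move=> A mA _; exact: gaussian_marginal.
rewrite ge0_integral_normal_prob//; last by move=> x; rewrite lee_fin sqr_ge0.
have [K K0 hK] := sqr_normal_pdf_le.
apply: (@le_lt_trans _ _ (\int[lebesgue_measure]_x
    (K%:E * (normal_pdf 0%R (sd * Num.sqrt 2) x)%:E))%E).
  apply: ge0_le_integral => //.
  - by move=> x _; rewrite -EFinM lee_fin mulr_ge0 ?sqr_ge0 ?normal_pdf_ge0.
  - apply: emeasurable_funM => //; apply/measurable_EFinP.
    exact: measurable_normal_pdf.
  - apply: emeasurable_funM => //; apply/measurable_EFinP.
    exact: measurable_normal_pdf.
  - by move=> x _; rewrite -!EFinM lee_fin; exact: hK.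
rewrite ge0_integralZl//.
- by rewrite integral_normal_pdf mule1 ltry.
- by apply/measurable_EFinP; exact: measurable_normal_pdf.
- by move=> x _; rewrite lee_fin normal_pdf_ge0.
Qed.

Lemma normal_prob_itv_gt0 (a b : R) : a < b ->
  (0 < normal_prob 0%R sd `]a, b[%classic)%E.
Proof.
(* [M] bounds the modulus on the interval, so the density is at least its value [dl] at [M]. *)
move=> ab; pose M := Num.max `|a| `|b|.
pose dl := normal_peak sd * expR (- (M ^+ 2) / (sd ^+ 2 *+ 2)).
have dl0 : 0 < dl by rewrite mulr_gt0 ?expR_gt0 ?normal_peak_gt0.
apply: (@lt_le_trans _ _ (\int[lebesgue_measure]_(x in `]a, b[%classic) dl%:E)%E).
  rewrite integral_cst//= lebesgue_measure_itv/= lte_fin ab -EFinB -EFinM lte_fin.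
  by rewrite mulr_gt0// subr_gt0.
apply: ge0_le_integral => //=.
- by move=> x _; rewrite lee_fin ltW.
- by apply/measurable_EFinP/measurable_funTS; exact: measurable_normal_pdf.
move=> x; rewrite in_itv/= => /andP[ax xb].
rewrite lee_fin normal_pdfE//= ler_wpM2l ?normal_peak_ge0// ler_expR subr0.
rewrite ler_wpM2r// ?invr_ge0 ?mulrn_wge0 ?sqr_ge0// lerN2.
rewrite -[x ^+ 2]real_normK ?num_real// ler_pXn2r ?nnegrE//.
  by rewrite /M le_max !ler_norml; apply/orP; have [x0|x0] := leP 0 x; [right|left];
    have := ler_norm b; have := ler_norm (- a); rewrite normrN; lra.
by rewrite /M le_max normr_ge0.
Qed.

(** By independence the probability is a finite product of positive ones. An almost sure identity
    can thus be refuted by its failure on an open box. *)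
Lemma gaussian_box_gt0 (X : T -> I -> R) (x0 : I -> R) (e : R) : 0 < e ->
  gaussian_family P sd X ->
  measurable [set w | forall i, `|X w i - x0 i| < e] /\
  (0 < P [set w | forall i, `|X w i - x0 i| < e]%R)%E.
Proof.
move=> e0 gX0; have [_ gX] := gX0; pose B i : set R := `]x0 i - e, x0 i + e[%classic.
rewrite (_ : [set w | _] = [set w | forall i, B i (X w i)]); last first.
  by apply/seteqP; split => w /= h i; have := h i; rewrite /B/= in_itv/= ltr_distl.
have mB i : measurable (B i) by exact: measurable_itv.
split; first exact: (measurable_gaussian_rect gX0 mB).
rewrite (gX _ mB).
apply: (big_ind (fun x => 0 < x)%E) => //; first exact: mule_gt0.
by move=> i _; apply: normal_prob_itv_gt0; lra.
Qed.

End moments.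

(** * Complex and matrix functions with parts in an algebra of real functions *)

Section complex_functions.
Context {X : Type} {R : realType}.
Local Notation C := R[i].

(* Measurability and convergence of a complex-valued function are both reduced
   to its real and imaginary parts. *)
Record subalgebra (A : (X -> R) -> Prop) : Prop := Subalgebra {
  subalg_cst : forall c : R, A (fun=> c);
  subalg_add : forall f g, A f -> A g -> A (fun x => f x + g x);
  subalg_mul : forall f g, A f -> A g -> A (fun x => f x * g x) }.

Variable A : (X -> R) -> Prop.
Hypothesis sA : subalgebra A.

Definition complex_in (f : X -> C) : Prop :=
  A (fun x => complex.Re (f x)) /\ A (fun x => complex.Im (f x)).

Lemma subalg_opp f : A f -> A (fun x => - f x).
Proof.
move=> Af; rewrite (_ : (fun _ => _) = (fun x => -1 * f x)).
  exact: (subalg_mul sA (subalg_cst sA _) Af).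
by apply/funext => x; rewrite mulN1r.
Qed.

Lemma complex_in_cst c : complex_in (fun=> c).
Proof. by split; exact: subalg_cst. Qed.

Lemma complex_inD f g : complex_in f -> complex_in g ->
  complex_in (fun x => f x + g x).
Proof.
move=> [f1 f2] [g1 g2]; split.
  rewrite (_ : (fun _ => _) = (fun x => complex.Re (f x) + complex.Re (g x))).
    exact: subalg_add.
  by apply/funext => x; case: (f x); case: (g x).
rewrite (_ : (fun _ => _) = (fun x => complex.Im (f x) + complex.Im (g x))).
  exact: subalg_add.
by apply/funext => x; case: (f x); case: (g x).
Qed.

Lemma complex_inM f g : complex_in f -> complex_in g ->
  complex_in (fun x => f x * g x).
Proof.
move=> [f1 f2] [g1 g2]; split.
  rewrite (_ : (fun _ => _) = (fun x => complex.Re (f x) * complex.Re (g x) +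
      - (complex.Im (f x) * complex.Im (g x)))).
    by apply: (subalg_add sA); [|apply: subalg_opp]; exact: subalg_mul.
  by apply/funext => x; case: (f x); case: (g x).
rewrite (_ : (fun _ => _) = (fun x => complex.Re (f x) * complex.Im (g x) +
    complex.Im (f x) * complex.Re (g x))).
  by apply: (subalg_add sA); exact: subalg_mul.
by apply/funext => x; case: (f x); case: (g x).
Qed.

Lemma complex_in_conj f : complex_in f -> complex_in (fun x => Num.conj (f x)).
Proof.
move=> [f1 f2]; split.
  rewrite (_ : (fun _ => _) = (fun x => complex.Re (f x)))//.
  by apply/funext => x; case: (f x).
rewrite (_ : (fun _ => _) = (fun x => - complex.Im (f x))).
  exact: subalg_opp.
by apply/funext => x; case: (f x).
Qed.

Lemma complex_in_sum (J : Type) (s : seq J) (f : J -> X -> C) :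
  (forall j, complex_in (f j)) -> complex_in (fun x => \sum_(j <- s) f j x).
Proof.
move=> mf; elim: s => [|j s IH].
  by under eq_fun do rewrite big_nil; exact: complex_in_cst.
by under eq_fun do rewrite big_cons; exact: complex_inD.
Qed.

Lemma complex_in_prod (J : Type) (s : seq J) (f : J -> X -> C) :
  (forall j, complex_in (f j)) -> complex_in (fun x => \prod_(j <- s) f j x).
Proof.
move=> mf; elim: s => [|j s IH].
  by under eq_fun do rewrite big_nil; exact: complex_in_cst.
by under eq_fun do rewrite big_cons; exact: complex_inM.
Qed.

Definition mx_in m n (M : X -> 'M[C]_(m, n)) : Prop :=
  forall i j, complex_in (fun x => M x i j).

Lemma mx_in_cst m n (M : 'M[C]_(m, n)) : mx_in (fun=> M).
Proof. by move=> i j; exact: complex_in_cst. Qed.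

Lemma mx_inD m n (M N : X -> 'M[C]_(m, n)) :
  mx_in M -> mx_in N -> mx_in (fun x => M x + N x).
Proof. by move=> mM mN i j; under eq_fun do rewrite mxE; exact: complex_inD. Qed.

Lemma mx_inM m n p (M : X -> 'M[C]_(m, n)) (N : X -> 'M[C]_(n, p)) :
  mx_in M -> mx_in N -> mx_in (fun x => M x *m N x).
Proof.
move=> mM mN i j; under eq_fun do rewrite mxE.
by apply: complex_in_sum => k; exact: complex_inM.
Qed.

Lemma mx_in_tc m n (M : X -> 'M[C]_(m, n)) :
  mx_in M -> mx_in (fun x => (M x)^t*).
Proof. by move=> mM i j; under eq_fun do rewrite !mxE; exact: complex_in_conj. Qed.

Lemma complex_in_det n (M : X -> 'M[C]_n) :
  mx_in M -> complex_in (fun x => \det (M x)).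
Proof.
move=> mM; apply: complex_in_sum => s; apply: complex_inM.
  exact: complex_in_cst.
by apply: complex_in_prod => i.
Qed.

Lemma complex_in_tr n (M : X -> 'M[C]_n) :
  mx_in M -> complex_in (fun x => \tr (M x)).
Proof. by move=> mM; apply: complex_in_sum => i. Qed.

End complex_functions.

Lemma measurable_subalgebra d (T : measurableType d) (R : realType) :
  subalgebra (fun f : T -> R => measurable_fun [set: T] f).
Proof.
split; first by move=> c; exact: measurable_cst.
- by move=> f g; exact: measurable_funD.
- by move=> f g; exact: measurable_funM.
Qed.

Lemma cvg_subalgebra (X : Type) (R : realType) (F : set_system X) (x0 : X) :
  Filter F -> subalgebra (fun f : X -> R => f x @[x --> F] --> f x0).
Proof.
move=> FF; split; first by move=> c; exact: cvg_cst.
- by move=> f g; exact: cvgD.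
- by move=> f g; exact: cvgM.
Qed.

(** * Square integrability *)

Lemma integrable_combination d (T : measurableType d) (R : realType)
    (P : probability T R) (f g : T -> R) (a b : R) :
  P.-integrable setT (EFin \o f) -> P.-integrable setT (EFin \o g) ->
  P.-integrable setT (fun w => (a * f w + b * g w)%:E).
Proof.
move=> If Ig.
have /= h1 := integrableZl measurableT a If.
have /= h2 := integrableZl measurableT b Ig.
by have := integrableD measurableT h1 h2; apply: eq_integrable.
Qed.

Lemma le_integrable_real d (T : measurableType d) (R : realType)
    (P : probability T R) (f g : T -> R) :
  measurable_fun setT f -> (forall w, 0 <= f w <= g w) ->
  P.-integrable setT (EFin \o g) -> P.-integrable setT (EFin \o f).
Proof.
move=> mf fg Ig; apply: (le_integrable measurableT _ _ Ig).
  exact/measurable_EFinP.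
move=> w _ /=; have /andP[f0 fg0] := fg w.
by rewrite lee_fin !ger0_norm// (le_trans f0).
Qed.

Section square_integrable.
Context {d : measure_display} {T : measurableType d} {R : realType}.
Variable P : probability T R.
Local Notation C := R[i].

(** The squared modulus as an element of [R], whereas the norm of [R[i]] takes its values in
    [R[i]]. *)
Definition sqnormC (z : C) : R := complex.Re z ^+ 2 + complex.Im z ^+ 2.

Lemma sqnormC_ge0 z : 0 <= sqnormC z.
Proof. by rewrite addr_ge0// sqr_ge0. Qed.

Lemma sqnormCE z : (sqnormC z)%:C = `|z| ^+ 2.
Proof. exact: add_Re2_Im2. Qed.

Lemma sqnormC_gt0 z : z != 0 -> 0 < sqnormC z.
Proof. by move=> z0; rewrite -ltcR sqnormCE exprn_gt0// normr_gt0. Qed.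

Lemma sqnormCM x y : sqnormC (x * y) = sqnormC x * sqnormC y.
Proof. by apply: (@complexI R); rewrite rmorphM/= !sqnormCE normrM exprMn. Qed.

(** By the parallelogram law the gap is the squared modulus of [x - y]. *)
Lemma sqnormCD_le x y : sqnormC (x + y) <= 2 * sqnormC x + 2 * sqnormC y.
Proof.
case: x => a b; case: y => a' b'; rewrite /sqnormC/= -subr_ge0.
rewrite (_ : _ - _ = (a - a') ^+ 2 + (b - b') ^+ 2); last by ring.
by rewrite addr_ge0 ?sqr_ge0.
Qed.

Definition square_integrable (f : T -> C) : Prop :=
  complex_in (fun g => measurable_fun [set: T] g) f /\
  P.-integrable setT (fun w => (sqnormC (f w))%:E).

Let mT := measurable_subalgebra T R.

Lemma measurable_sqnormC f : complex_in (fun g => measurable_fun [set: T] g) f ->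
  measurable_fun setT (fun w => sqnormC (f w)).
Proof. by move=> [f1 f2]; apply: measurable_funD; apply: measurable_funX. Qed.

Lemma square_integrable0 : square_integrable (fun=> 0).
Proof.
split; first exact: (complex_in_cst mT).
by under eq_fun do rewrite /sqnormC/= expr0n addr0; exact: integrable0.
Qed.

Lemma square_integrableD f g : square_integrable f -> square_integrable g ->
  square_integrable (fun w => f w + g w).
Proof.
move=> [mf If] [mg Ig]; have mfg := complex_inD mT mf mg; split => //.
apply: (le_integrable_real (g := fun w => 2 * sqnormC (f w) + 2 * sqnormC (g w))).
- exact: measurable_sqnormC.
- by move=> w; rewrite sqnormC_ge0 sqnormCD_le.
- exact: integrable_combination.
Qed.

Lemma square_integrableZ c f : square_integrable f ->
  square_integrable (fun w => c * f w).
Proof.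
move=> [mf If]; split.
  exact: (complex_inM mT (complex_in_cst mT c) mf).
have := integrable_combination (sqnormC c) 0 If If.
by apply: eq_integrable => // w _; rewrite sqnormCM mul0r addr0.
Qed.

Lemma square_integrable_sum (J : Type) (s : seq J) (f : J -> T -> C) :
  (forall j, square_integrable (f j)) ->
  square_integrable (fun w => \sum_(j <- s) f j w).
Proof.
move=> mf; elim: s => [|j s IH].
  by under eq_fun do rewrite big_nil; exact: square_integrable0.
by under eq_fun do rewrite big_cons; exact: square_integrableD.
Qed.

Definition mx_square_integrable m n (M : T -> 'M[C]_(m, n)) : Prop :=
  forall i j, square_integrable (fun w => M w i j).

Lemma mx_square_integrableMl m n p (A : 'M[C]_(m, n)) (M : T -> 'M[C]_(n, p)) :
  mx_square_integrable M -> mx_square_integrable (fun w => A *m M w).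
Proof.
move=> hM i j; under eq_fun do rewrite mxE.
by apply: square_integrable_sum => k; exact: square_integrableZ.
Qed.

Lemma mx_square_integrableMr m n p (M : T -> 'M[C]_(m, n)) (A : 'M[C]_(n, p)) :
  mx_square_integrable M -> mx_square_integrable (fun w => M w *m A).
Proof.
move=> hM i j; under eq_fun do rewrite mxE.
apply: square_integrable_sum => k.
by under eq_fun do rewrite mulrC; exact: square_integrableZ.
Qed.

Lemma Retr_gram m n (Y : 'M[C]_(m, n)) :
  complex.Re (\tr (Y *m Y^t*)) = \sum_i \sum_j sqnormC (Y i j).
Proof.
have -> : \tr (Y *m Y^t*) = (\sum_i \sum_j sqnormC (Y i j))%:C.
  rewrite rmorph_sum; apply: eq_bigr => i _; rewrite mxE rmorph_sum.
  by apply: eq_bigr => j _; rewrite !mxE /= sqnormCE normCK.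
by [].
Qed.

Lemma integrable_Retr_gram m n (Y : T -> 'M[C]_(m, n)) :
  mx_square_integrable Y ->
  P.-integrable setT (fun w => (complex.Re (\tr (Y w *m (Y w)^t*)))%:E).
Proof.
move=> hY.
under eq_fun do rewrite Retr_gram -sumEFin.
apply: integrable_sum => // i _.
under eq_fun do rewrite -sumEFin.
by apply: integrable_sum => // j _; have [] := hY i j.
Qed.

Lemma gaussian_square_integrable m n (Z : T -> 'M[C]_(m, n)) (sd : R) :
  sd != 0 -> gaussian_family P sd (fun w => coords_of_mx (Z w)) ->
  mx_square_integrable Z.
Proof.
move=> sd0 gZ i j.
have [mZ _] := gZ.
split; first by split; [exact: (mZ (i, j, false))|exact: (mZ (i, j, true))].
have h1 := gaussian_sqr_integrable sd0 (i, j, false) gZ.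
have h2 := gaussian_sqr_integrable sd0 (i, j, true) gZ.
have := integrable_combination 1 1 h1 h2.
by apply: eq_integrable => // w _; rewrite !mul1r.
Qed.

End square_integrable.

Lemma psd_factor (R : realType) n (Q : 'M[R[i]]_n) :
  psd Q -> exists L : 'M[R[i]]_n, Q = L *m L^t*.
Proof.
move=> pQ; have [hQ _] := pQ.
have [|P [r [PP PP' r0 ->]]] := @herm_spectral R n Q 0 hQ.
  rewrite (_ : (0%:C)%:M = 0) ?subr0//.
  by apply/matrixP => i j; rewrite !mxE rmorph0 mul0rn.
exists (P^t* *m diagC (map_mx Num.sqrt r)).
have rE : \row_i (map_mx Num.sqrt r 0 i * map_mx Num.sqrt r 0 i) = r.
  by apply/rowP => i; rewrite !mxE -expr2 sqr_sqrtr.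
by rewrite tcmxM diagC_tc trmxCK mulmxA -[in RHS](mulmxA (P^t*)) diagC_mul rE.
Qed.

(** * The received signal in the eigenbasis of the transmit correlation *)

Section received_signal.
Context {R : realType} {NR NS : nat}.
Local Notation C := R[i].
Variable Ut : 'M[C]_NS.
Variable lt : 'rV[R]_NS.
Hypothesis UtU : Ut^t* *m Ut = 1%:M.

Local Notation D := (diagC (map_mx Num.sqrt lt)).

(* Here Q = Ut W Ut^H, and b is the deterministic part on the left of M. *)
Definition received p (b : 'M[C]_(p, NR)) (M : 'M[C]_(NR, NS)) (W : 'M[C]_NS) :
    'M[C]_p :=
  let Y := b *m M *m Ut *m D in Y *m W *m Y^t*.

Definition received_power p (b : 'M[C]_(p, NR)) M W : R :=
  complex.Re (\tr (received b M W)).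

Definition signflip (i : 'I_NS) : 'M[C]_NS :=
  diagC (\row_k (if k == i then -1 else 1)).

Definition flip_conj i W := signflip i *m W *m signflip i.

Lemma received_psd p (b : 'M[C]_(p, NR)) M W : psd W -> psd (received b M W).
Proof. by move=> pW; apply: psd_congr. Qed.

Lemma receivedD p (b : 'M[C]_(p, NR)) M W1 W2 :
  received b M (W1 + W2) = received b M W1 + received b M W2.
Proof. by rewrite /received mulmxDr mulmxDl. Qed.

Lemma receivedN p (b : 'M[C]_(p, NR)) M W :
  received b M (- W) = - received b M W.
Proof. by rewrite /received mulmxN mulNmx. Qed.

Lemma receivedZ p (b : 'M[C]_(p, NR)) M (c : C) W :
  received b M (c *: W) = c *: received b M W.
Proof. by rewrite /received -scalemxAr -scalemxAl. Qed.

Lemma received_powerD p (b : 'M[C]_(p, NR)) M W1 W2 :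
  received_power b M (W1 + W2) = received_power b M W1 + received_power b M W2.
Proof. by rewrite /received_power receivedD raddfD/= complex_ReD. Qed.

Lemma received_powerZ p (b : 'M[C]_(p, NR)) M (c : R) W :
  received_power b M (c%:C *: W) = c * received_power b M W.
Proof.
rewrite /received_power receivedZ mxtraceZ.
by case: (\tr _) => x y /=; rewrite mul0r subr0.
Qed.

Lemma received_power_ge0 p (b : 'M[C]_(p, NR)) M W :
  psd W -> 0 <= received_power b M W.
Proof. by move=> pW; apply: psd_Retr_ge0; exact: received_psd. Qed.

Lemma signflip_tc i : (signflip i)^t* = signflip i.
Proof. exact: diagC_tc. Qed.

Lemma signflipK i : signflip i *m signflip i = 1%:M.
Proof.
rewrite diagC_mul -diagC1; congr diagC; apply/rowP => k; rewrite !mxE.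
by case: ifP; rewrite ?mulrNN mulr1.
Qed.

Lemma flip_conj_psd i W : psd W -> psd (flip_conj i W).
Proof.
by move=> pW; rewrite /flip_conj -[X in _ *m X]signflip_tc; exact: psd_congr.
Qed.

Lemma flip_conjE i W a b :
  flip_conj i W a b = if (a == i) == (b == i) then W a b else - W a b.
Proof.
rewrite /flip_conj /signflip /diagC mul_mx_diag mul_diag_mx !mxE.
by case: (a == i); case: (b == i);
  rewrite /= ?rmorphN ?rmorph1 ?(mulN1r, mulrN1, mul1r, mulr1, opprK).
Qed.

Lemma signflip_reflection i :
  Ut *m signflip i = (1%:M - 2%:R *: (col i Ut *m (col i Ut)^t*)) *m Ut.
Proof.
have -> : signflip i = 1%:M - 2%:R *: (delta_mx i 0 *m (delta_mx i (0 : 'I_1))^t*).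
  rewrite trmx_delta map_delta_mx mul_delta_mx.
  apply/matrixP => a b; rewrite !mxE.
  case: (eqVneq a b) => [<-|ab]; last first.
    rewrite mulr0n (_ : (_ == i) && _ = false) ?mulr0 ?subr0//.
    by apply/negP => /andP[/eqP ai /eqP bi]; rewrite ai bi eqxx in ab.
  rewrite andbb mulr1n; case: eqP => _; last by rewrite mulr0 subr0 rmorph1.
  by rewrite rmorphN rmorph1 mulr1 mulr1n; ring.
rewrite mulmxBr mulmxBl mulmx1 mul1mx; congr (_ - _).
rewrite -scalemxAr -scalemxAl; congr (_ *: _).
by rewrite colE tcmxM -!mulmxA UtU mulmx1.
Qed.

(** The sign matrix commutes with the diagonal [D], and passing through [Ut] turns it into the
    reflection along column [i]; the sign change of [W] thus becomes a reflection of the channel. *)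
Lemma received_flip p (b : 'M[C]_(p, NR)) M i W :
  received b M (flip_conj i W) =
  received b (M *m (1%:M - 2%:R *: (col i Ut *m (col i Ut)^t*))) W.
Proof.
have DF : D *m signflip i = signflip i *m D.
  by rewrite !diagC_mul; congr diagC; apply/rowP => k; rewrite !mxE mulrC.
have YF : b *m (M *m (1%:M - 2%:R *: (col i Ut *m (col i Ut)^t*))) *m Ut *m D =
    b *m M *m Ut *m D *m signflip i.
  have -> : b *m M *m Ut *m D *m signflip i = b *m M *m (Ut *m signflip i) *m D.
    by rewrite -(mulmxA (b *m M *m Ut)) DF !mulmxA.
  by rewrite signflip_reflection !mulmxA.
by rewrite /received/= YF [in RHS]tcmxM signflip_tc /flip_conj !mulmxA.
Qed.

Definition erase (i : 'I_NS) : 'M[C]_NS := diagC (\row_k (k != i)%:R).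

Definition erase_conj i W := erase i *m W *m erase i.

Lemma erase_conj_psd i W : psd W -> psd (erase_conj i W).
Proof.
move=> pW; rewrite /erase_conj -[X in _ *m X]diagC_tc; exact: psd_congr.
Qed.

(** The factor [D] on either side of [W] has a zero at index [i], so it erases that index
    already. *)
Lemma received_erase p (b : 'M[C]_(p, NR)) M i W : lt 0 i = 0 ->
  received b M (erase_conj i W) = received b M W.
Proof.
move=> lti.
have DE : D *m erase i = D.
  rewrite diagC_mul; congr diagC; apply/rowP => k; rewrite !mxE.
  by case: eqP => [->|_]; rewrite ?lti ?sqrtr0 ?mul0r ?mulr1.
have ED : erase i *m D = D.
  rewrite diagC_mul; congr diagC; apply/rowP => k; rewrite !mxE.
  by case: eqP => [->|_]; rewrite ?lti ?sqrtr0 ?mulr0 ?mul1r.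
rewrite /received /erase_conj tcmxM diagC_tc !mulmxA -(mulmxA _ D (erase i)) DE.
by rewrite -!mulmxA (mulmxA (erase i)) ED.
Qed.

Lemma source_erase i W :
  source_power (erase_conj i W) = source_power W - complex.Re (W i i).
Proof.
rewrite /source_power /mxtrace [in RHS](bigD1 i)//= complex_ReD addrAC subrr add0r.
rewrite (bigD1 i)//= /erase_conj /erase /diagC mul_mx_diag mul_diag_mx !mxE eqxx.
rewrite rmorph0 mul0r mulr0 add0r; congr complex.Re; apply: eq_bigr => k ki.
by rewrite !mxE ki rmorph1 mulr1 mul1r.
Qed.

Lemma source_flip i W : source_power (flip_conj i W) = source_power W.
Proof.
by rewrite /source_power /flip_conj mxtrace_mulC mulmxA signflipK mul1mx.
Qed.

Lemma source_powerD (W1 W2 : 'M[C]_NS) :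
  source_power (W1 + W2) = source_power W1 + source_power W2.
Proof. by rewrite /source_power raddfD/= complex_ReD. Qed.

(** The pinching of [W] at index [i], which is the average of [W] and [flip_conj i W]. *)
Definition decouple (i : 'I_NS) (W : 'M[C]_NS) : 'M[C]_NS :=
  \matrix_(a, b) if (a == i) == (b == i) then W a b else 0.

Lemma decouple_sum i W : W + flip_conj i W = decouple i W + decouple i W.
Proof.
apply/matrixP => a b; rewrite [LHS]mxE [RHS]mxE flip_conjE mxE.
by case: ifP => _ //; rewrite subrr addr0.
Qed.

Lemma decoupleE i W : decouple i W = (2^-1)%:C *: (W + flip_conj i W).
Proof.
rewrite decouple_sum scalerDr -scalerDl.
have -> : (2^-1)%:C + (2^-1)%:C = 1 :> C.
  by rewrite -rmorphD -[RHS](rmorph1 (real_complex R)); congr _%:C; lra.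
by rewrite scale1r.
Qed.

Lemma decouple_psd i W : psd W -> psd (decouple i W).
Proof.
move=> pW; rewrite decoupleE; apply: psdZ; first by rewrite invr_ge0.
exact: (psdD pW (flip_conj_psd i pW)).
Qed.

Lemma source_decouple i W : source_power (decouple i W) = source_power W.
Proof.
have := congr1 (@source_power R NS) (decouple_sum i W).
by rewrite !source_powerD source_flip; lra.
Qed.

End received_signal.

(** * Mean gain and mean power *)

Lemma addrr_inj (R : realType) (x y : R) : x + x = y + y -> x = y.
Proof. by lra. Qed.

Lemma ler_addrr2 (R : realType) (x x' y : R) :
  x' = x -> x + x' <= y + y -> x <= y.
Proof. by move=> ->; lra. Qed.

Lemma ler_add2_eq (R : realType) (x x' y : R) :
  x' = x -> y <= x -> y + y <= x + x'.
Proof. by move=> ->; lra. Qed.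

Lemma integrable_add d (T : measurableType d) (R : realType)
    (P : probability T R) (f g : T -> R) :
  P.-integrable setT (EFin \o f) -> P.-integrable setT (EFin \o g) ->
  P.-integrable setT (EFin \o (fun w => f w + g w)).
Proof. by move=> If Ig; exact: (integrableD measurableT If Ig). Qed.

Lemma integrable_scale d (T : measurableType d) (R : realType)
    (P : probability T R) (f : T -> R) (c : R) :
  P.-integrable setT (EFin \o f) ->
  P.-integrable setT (EFin \o (fun w => c * f w)).
Proof. by move=> If; exact: (integrableZl measurableT c If). Qed.

(** The nonnegative function [g - f] has zero integral, hence vanishes almost everywhere. *)
Lemma Rintegral_eq_ae d (T : measurableType d) (R : realType)
    (P : probability T R) (f g : T -> R) :
  P.-integrable setT (EFin \o f) -> P.-integrable setT (EFin \o g) ->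
  (forall w, f w <= g w) -> \int[P]_w g w <= \int[P]_w f w ->
  {ae P, forall w, f w = g w}.
Proof.
move=> If Ig fg gf.
have Ih : P.-integrable setT (EFin \o (fun w => g w - f w)).
  exact: (integrableB measurableT Ig If).
have h0 w : 0 <= g w - f w by rewrite subr_ge0.
have int0 : \int[P]_w (g w - f w) = 0.
  apply/eqP; rewrite eq_le Rintegral_ge0 ?andbT//.
  by rewrite RintegralB// subr_le0.
have /(ae_eq_integral_abs P measurableT (measurable_int _ Ih)) :
    (\int[P]_w `|(g w - f w)%:E| = 0)%E.
  under eq_integral do rewrite gee0_abs ?lee_fin//.
  rewrite -[LHS]fineK; last exact: (integrable_fin_num _ Ih).
  by rewrite [fine _]int0.
apply: filterS => w /(_ Logic.I)[/eqP].
by rewrite subr_eq0 => /eqP.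
Qed.

Lemma le_RintegralD d (T : measurableType d) (R : realType)
    (P : probability T R) (f1 f2 g : T -> R) :
  P.-integrable setT (EFin \o f1) -> P.-integrable setT (EFin \o f2) ->
  P.-integrable setT (EFin \o g) ->
  (forall w, f1 w + f2 w <= g w + g w) ->
  \int[P]_w f1 w + \int[P]_w f2 w <= \int[P]_w g w + \int[P]_w g w /\
  (\int[P]_w g w + \int[P]_w g w <= \int[P]_w f1 w + \int[P]_w f2 w ->
   {ae P, forall w, f1 w + f2 w = g w + g w}).
Proof.
move=> I1 I2 Ig fg; have I12 := integrable_add I1 I2.
have Igg := integrable_add Ig Ig.
rewrite -(RintegralD measurableT I1 I2) -(RintegralD measurableT Ig Ig).
split; first by apply: le_Rintegral.
exact: Rintegral_eq_ae.
Qed.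

Section expected_gain.
Context {d : measure_display} {T : measurableType d} {R : realType}.
Variable P : probability T R.
Context {NR NS : nat}.
Local Notation C := R[i].
Local Notation I := ('I_NR * 'I_NS * bool)%type.
Local Notation sd := (Num.sqrt (1 / 2 : R)).
Variable Z : T -> 'M[C]_(NR, NS).
Hypothesis gZ : gaussian_family P sd (fun w => coords_of_mx (Z w)).
Variable Ut : 'M[C]_NS.
Variable lt : 'rV[R]_NS.
Hypothesis UtU : Ut^t* *m Ut = 1%:M.
Variables (p : nat) (b : 'M[C]_(p, NR)).

Local Notation received := (received Ut lt).
Local Notation received_power := (received_power Ut lt).

(** Stated for any [subalgebra] because it serves both measurability and convergence along a
    filter. *)
Lemma mx_in_received (X : Type) (A : (X -> R) -> Prop)
    (M : X -> 'M[C]_(NR, NS)) W :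
  subalgebra A -> mx_in A M -> mx_in A (fun x => received b (M x) W).
Proof.
move=> sA mM.
have mY : mx_in A (fun x => b *m M x *m Ut *m diagC (map_mx Num.sqrt lt)).
  do 2 (apply: (mx_inM sA); last exact: (mx_in_cst sA)).
  by apply: (mx_inM sA) => //; exact: (mx_in_cst sA).
apply: (mx_inM sA); last exact: (mx_in_tc sA).
by apply: (mx_inM sA) => //; exact: (mx_in_cst sA).
Qed.

Lemma measurable_received_power d' (X : measurableType d')
    (M : X -> 'M[C]_(NR, NS)) W :
  mx_in (fun f => measurable_fun [set: X] f) M ->
  measurable_fun [set: X] (fun x => received_power b (M x) W).
Proof.
move=> mM; have [h _] := complex_in_tr (measurable_subalgebra X R)
  (mx_in_received W (measurable_subalgebra X R) mM).
exact: h.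
Qed.

Lemma mx_in_channel : mx_in (fun f => measurable_fun [set: T] f) Z.
Proof.
move=> i j; have [mZ _] := gZ.
by split; [exact: (mZ (i, j, false))|exact: (mZ (i, j, true))].
Qed.

Lemma mx_in_coords :
  mx_in (fun f => measurable_fun [set: coordType I R] f)
    (fun x : coordType I R => mx_of_coords x).
Proof.
by move=> i j; split; under eq_fun do rewrite mxE; exact: measurable_coord.
Qed.

(** With [W = L L^H], the received power is the squared Frobenius norm of a matrix that is linear in
    [Z], and Gaussian entries are square integrable. *)
Lemma integrable_received_power W : psd W ->
  P.-integrable setT (EFin \o (fun w => received_power b (Z w) W)).
Proof.
move=> /psd_factor[L ->].
pose Y w := b *m Z w *m (Ut *m diagC (map_mx Num.sqrt lt) *m L).
have hY : mx_square_integrable P Y.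
  apply: mx_square_integrableMr; apply: mx_square_integrableMl.
  exact: (gaussian_square_integrable sd_neq0 gZ).
have YE w : received b (Z w) (L *m L^t*) = Y w *m (Y w)^t*.
  by rewrite /received/= /Y !tcmxM !mulmxA.
rewrite /received_power /comp; under eq_fun do rewrite YE.
exact: integrable_Retr_gram hY.
Qed.

Lemma expectation_reflection (u : 'cV[C]_NS) (f : 'M[C]_(NR, NS) -> R) :
  (u^t* *m u) 0 0 = 1 ->
  measurable_fun [set: coordType I R] (fun x : coordType I R => f (mx_of_coords x)) ->
  (forall M, 0 <= f M) ->
  (\int[P]_w f (Z w *m (1%:M - 2%:R *: (u *m u^t*))) = \int[P]_w f (Z w))%R.
Proof.
move=> u1 mf f0; have [Y gY YE] := gaussian_reflection u1 gZ.
rewrite /Rintegral; congr fine.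
have := gaussian_family_integral gY gZ (f := fun x => (f (mx_of_coords x))%:E).
move=> /(_ _ _)/= h.
transitivity (\int[P]_w (f (mx_of_coords (Y w)))%:E)%E.
  by apply: eq_integral => w _; rewrite YE coords_of_mxK.
rewrite h; last 2 first.
- exact/measurable_EFinP.
- by move=> x; rewrite lee_fin.
by apply: eq_integral => w _; rewrite coords_of_mxK.
Qed.

Lemma col_unit i : ((col i Ut)^t* *m col i Ut) 0 0 = 1 :> C.
Proof.
rewrite colE tcmxM -mulmxA (mulmxA (Ut^t*)) UtU mul1mx.
by rewrite trmx_delta map_delta_mx mul_delta_mx mxE !eqxx.
Qed.

Definition mean_power W : R := \int[P]_w received_power b (Z w) W.

Lemma mean_power_flip i W : psd W -> mean_power (flip_conj i W) = mean_power W.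
Proof.
move=> pW.
rewrite /mean_power.
rewrite -(expectation_reflection (col_unit i) (f := fun M => received_power b M W)).
- by apply: eq_Rintegral => w _; rewrite /received_power received_flip.
- exact: (measurable_received_power _ mx_in_coords).
- by move=> M; exact: received_power_ge0.
Qed.

Lemma mean_powerD W1 W2 : psd W1 -> psd W2 ->
  mean_power (W1 + W2) = mean_power W1 + mean_power W2.
Proof.
move=> p1 p2; rewrite /mean_power.
rewrite -(RintegralD measurableT (integrable_received_power p1)
  (integrable_received_power p2)).
by apply: eq_Rintegral => w _; exact: received_powerD.
Qed.

Lemma mean_power_ge0 W : psd W -> 0 <= mean_power W.
Proof. by move=> pW; apply: Rintegral_ge0 => // w _; exact: received_power_ge0. Qed.

Lemma mean_power_decouple i W : psd W -> mean_power (decouple i W) = mean_power W.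
Proof.
move=> pW; have pF := flip_conj_psd i pW; have pD := decouple_psd i pW.
have := mean_powerD pD pD; rewrite -decouple_sum => e.
have := mean_powerD pW pF; rewrite e (mean_power_flip i pW).
exact: addrr_inj.
Qed.

Variable N : 'M[C]_p.
Variable s : R.
Hypothesis s0 : 0 < s.
Hypothesis pN : psd (N - (s%:C)%:M).

(** [N] stands for the noise covariance at the destination; the logarithm of the determinant ratio
    is written as a difference. *)
Definition gain (M : 'M[C]_(NR, NS)) W : R := lndet (N + received b M W) - lndet N.

Definition mean_gain W : R := \int[P]_w gain (Z w) W.

Lemma gain_ge0 M W : psd W -> 0 <= gain M W.
Proof.
move=> pW; rewrite /gain subr_ge0.
exact: (lndet_le s0 pN (received_psd Ut lt b M pW)).
Qed.

(** This majorant makes the gain integrable. *)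
Lemma gain_le M W : psd W -> gain M W <= received_power b M W / s.
Proof.
move=> pW; rewrite /gain lerBlDl.
exact: (lndetD_le s0 pN (received_psd Ut lt b M pW)).
Qed.

Lemma measurable_gain d' (X : measurableType d') (M : X -> 'M[C]_(NR, NS)) W :
  mx_in (fun f => measurable_fun [set: X] f) M ->
  measurable_fun [set: X] (fun x => gain (M x) W).
Proof.
move=> mM; have mX := measurable_subalgebra X R.
apply: measurable_funB => //; apply: (measurableT_comp (@measurable_ln R)).
have [h _] := complex_in_det mX (mx_inD mX (mx_in_cst mX N) (mx_in_received W mX mM)).
exact: h.
Qed.

Lemma integrable_gain W : psd W ->
  P.-integrable setT (EFin \o (fun w => gain (Z w) W)).
Proof.
move=> pW; apply: (le_integrable_real (g := fun w => received_power b (Z w) W / s)).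
- exact: (measurable_gain _ mx_in_channel).
- by move=> w; rewrite gain_ge0// gain_le.
- have I1 := integrable_received_power pW.
  have := integrable_combination (s^-1) 0 I1 I1.
  by apply: eq_integrable => // w _ /=; rewrite mul0r addr0 mulrC.
Qed.

Lemma mean_gain_flip i W : psd W -> mean_gain (flip_conj i W) = mean_gain W.
Proof.
move=> pW.
have e := expectation_reflection (col_unit i) (measurable_gain W mx_in_coords)
  (fun M => gain_ge0 M pW).
rewrite /mean_gain -[RHS]e; apply: eq_Rintegral => w _.
by rewrite /gain received_flip.
Qed.

Lemma gain_decouple M i W : psd W ->
  gain M W + gain M (flip_conj i W) <=
    gain M (decouple i W) + gain M (decouple i W) /\
  (gain M W + gain M (flip_conj i W) =
     gain M (decouple i W) + gain M (decouple i W) ->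
   received b M W = received b M (flip_conj i W)).
Proof.
move=> pW; have pF := flip_conj_psd i pW.
have := congr1 (received b M) (decouple_sum i W); rewrite !receivedD.
have := received_psd Ut lt b M pW; have := received_psd Ut lt b M pF.
rewrite /gain.
move: (received b M W) (received b M (flip_conj i W)) (received b M (decouple i W)).
move=> X Y V pY pX XY.
have [|] := lndet_midpoint s0 (ge_scalarD pN pX) (ge_scalarD pN pY)
  (_ : _ = (N + V) + (N + V)); first by rewrite addrACA XY addrACA.
move: (lndet _) (lndet _) (lndet _) (lndet _) => x y z t h1 h2.
split; first by lra.
by move=> e; apply: (addrI N); apply: h2; lra.
Qed.

(** Since [W] and [flip_conj i W] have equal mean gains, integrating midpoint concavity compares
    [mean_gain W] with the mean gain of the midpoint. If nothing is gained, concavity is tight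
    almost surely, and its equality case identifies the received covariances. *)
Lemma mean_gain_decouple i W : psd W ->
  mean_gain W <= mean_gain (decouple i W) /\
  (mean_gain (decouple i W) <= mean_gain W ->
   {ae P, forall w, received b (Z w) W = received b (Z w) (flip_conj i W)}).
Proof.
move=> pW; have pF := flip_conj_psd i pW; have pD := decouple_psd i pW.
have [le_gain eq_gain] := le_RintegralD (integrable_gain pW) (integrable_gain pF)
  (integrable_gain pD) (fun w => proj1 (gain_decouple (Z w) i pW)).
have e := mean_gain_flip i pW.
split; first exact: (ler_addrr2 e le_gain).
move=> /(ler_add2_eq e) /eq_gain.
by apply: filterS => w; exact: (proj2 (gain_decouple (Z w) i pW)).
Qed.

Lemma mean_gain_erase i W : lt 0 i = 0 ->
  mean_gain (erase_conj i W) = mean_gain W.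
Proof.
move=> lti; apply: eq_Rintegral => w _.
by rewrite /gain (received_erase _ _ _ _ lti).
Qed.

Lemma mean_power_erase i W : lt 0 i = 0 ->
  mean_power (erase_conj i W) = mean_power W.
Proof.
move=> lti; apply: eq_Rintegral => w _.
by rewrite /received_power (received_erase _ _ _ _ lti).
Qed.

(** The last hypothesis is [W <= W' + e I] in the Loewner order. Monotonicity replaces [W] by
    [W' + e I], and [lndetD_le] bounds the effect of [e I] by an integrable multiple of [e]. *)
Lemma gain_lipschitz M W W' (e : R) : 0 <= e -> psd W -> psd W' ->
  psd (W' + (e%:C)%:M - W) ->
  gain M W <= gain M W' + e / s * received_power b M 1%:M.
Proof.
move=> e0 pW pW' pd.
have p1 := received_psd Ut lt b M pW; have p1' := received_psd Ut lt b M pW'.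
have pe : psd ((e%:C)%:M : 'M[C]_NS) by exact: psd_scalar.
have E : received b M W + received b M (W' + (e%:C)%:M - W) =
    received b M W' + received b M (e%:C)%:M.
  by rewrite -!receivedD addrC subrK.
have h1 := lndet_le s0 (ge_scalarD pN p1) (received_psd Ut lt b M pd).
have h2 := lndetD_le s0 (ge_scalarD pN p1') (received_psd Ut lt b M pe).
have E2 : complex.Re (\tr (received b M (e%:C)%:M)) = e * received_power b M 1%:M.
  by rewrite -received_powerZ scalemx1.
rewrite -addrA E addrA in h1; rewrite E2 in h2.
rewrite /gain lerBlDr; apply: (le_trans h1); apply: (le_trans h2).
by rewrite addrAC subrK mulrAC.
Qed.

Lemma mean_gain_lipschitz W W' (e : R) : 0 <= e -> psd W -> psd W' ->
  psd (W' + (e%:C)%:M - W) ->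
  mean_gain W <= mean_gain W' + e / s * mean_power 1%:M.
Proof.
move=> e0 pW pW' pd.
have I1 := integrable_received_power (psd1 NS).
have I2 := integrable_scale (e / s) I1.
have IW' := integrable_gain pW'.
have h := le_Rintegral measurableT (integrable_gain pW) (integrable_add IW' I2)
  (fun w _ => gain_lipschitz (Z w) e0 pW pW' pd).
apply: (le_trans h).
by rewrite (RintegralD measurableT IW' I2) (RintegralZl _ measurableT I1).
Qed.

Lemma mean_power_lipschitz W W' (e : R) : 0 <= e -> psd W -> psd W' ->
  psd (W' + (e%:C)%:M - W) ->
  mean_power W <= mean_power W' + e * mean_power 1%:M.
Proof.
move=> e0 pW pW' pd.
have I1 := integrable_received_power (psd1 NS).
have I2 := integrable_scale e I1.
have IW' := integrable_received_power pW'.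
have h w : received_power b (Z w) W <=
    received_power b (Z w) W' + e * received_power b (Z w) 1%:M.
  rewrite -received_powerZ scalemx1 -received_powerD.
  rewrite -[X in _ <= received_power _ _ X](subrK W) [X in _ <= X]received_powerD.
  by rewrite lerDr received_power_ge0.
have h' := le_Rintegral measurableT (integrable_received_power pW)
  (integrable_add IW' I2) (fun w _ => h w).
apply: (le_trans h').
by rewrite (RintegralD measurableT IW' I2) (RintegralZl _ measurableT I1).
Qed.

Lemma mean_gain0 W : b = 0 -> mean_gain W = 0.
Proof.
move=> b0; transitivity (\int[P]_w (0 : R)); last by rewrite Rintegral_cst// mul0r.
apply: eq_Rintegral => w _.
by rewrite /gain /received/= b0 !mul0mx addr0 subrr.
Qed.

(* The quadratic form below is a nonzero polynomial in the entries of Z, so it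
   is nonzero on an open box, which has positive probability. *)
Lemma received_flip_not_ae i j W : psd W -> b != 0 ->
  i != j -> W i j != 0 -> 0 < lt 0 i -> 0 < lt 0 j ->
  ~ {ae P, forall w, received b (Z w) W = received b (Z w) (flip_conj i W)}.
Proof.
move=> [/hermP hW _] b0 ij Wij lti ltj ae_eq.
have [q [r bqr]] : exists q r, b q r != 0.
  apply: contrapT => h; move/eqP: b0; apply; apply/matrixP => q r.
  by rewrite mxE; apply/eqP; apply: contrapT => /negP ?; apply: h; exists q, r.
pose Dl := W - flip_conj i W.
have DE a a' : Dl a a' = if (a == i) == (a' == i) then 0 else W a a' + W a a'.
  by rewrite [LHS]mxE [X in _ + X]mxE flip_conjE; case: ifP => _; rewrite ?subrr ?opprK.
have ji : (j == i) = false by rewrite eq_sym (negbTE ij).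
have Dji : Dl j i = Num.conj (Dl i j).
  rewrite !DE ji eqxx/= rmorphD.
  by have /matrixP/(_ j i) := hW; rewrite !mxE => <-.
have Dij : Dl i j != 0.
  by rewrite DE ji eqxx/= -mulr2n mulrn_eq0.
have Dii : Dl i i = 0 by rewrite DE eqxx.
have Djj : Dl j j = 0 by rewrite DE eqxx.
pose si := Num.sqrt (lt 0 i); pose sj := Num.sqrt (lt 0 j).
have si0 : 0 < si by rewrite sqrtr_gt0.
have sj0 : 0 < sj by rewrite sqrtr_gt0.
(* The row [z] is supported on [i] and [j], where [Dl] has zero diagonal entries. The weight [c]
   aligns the phases: both cross terms of [z Dl z^H] equal [si sj |c|^2] and cannot cancel. The
   matrix [M0] has rank one and is chosen so that [b M0 Ut D] is column [r] of [b] times [z]. *)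
pose c := Dl i j.
pose v : 'rV[C]_NS := (delta_mx 0 i + c *: delta_mx 0 j) *m Ut^t*.
pose z : 'rV[C]_NS := si%:C *: delta_mx 0 i + (sj%:C * c) *: delta_mx 0 j.
pose M0 : 'M[C]_(NR, NS) := delta_mx r (0 : 'I_1) *m v.
have vz : v *m Ut *m diagC (map_mx Num.sqrt lt) = z.
  rewrite /v -(mulmxA _ (Ut^t*)) UtU mulmx1.
  apply/rowP => k; rewrite /diagC mul_mx_diag !mxE eqxx /=.
  rewrite mulrDl; congr (_ + _).
    by case: eqP => [->|_]; rewrite ?mul1r ?mulr1 ?mul0r ?mulr0.
  by case: eqP => [->|_]; rewrite ?mulr1 ?mulr0 ?mul0r// mulrC.
have zDz : (z *m Dl *m z^t*) 0 0 = (2 * si * sj * sqnormC c)%:C.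
  pose B (x y : 'rV[C]_NS) := (x *m Dl *m y^t*) 0 0.
  have BDl x x' y : B (x + x') y = B x y + B x' y.
    by rewrite /B !mulmxDl mxE.
  have BDr x y y' : B x (y + y') = B x y + B x y'.
    by rewrite /B tcmxD mulmxDr mxE.
  have BZl a x y : B (a *: x) y = a * B x y.
    by rewrite /B -!scalemxAl mxE.
  have BZr a x y : B x (a *: y) = Num.conj a * B x y.
    by rewrite /B tcmxZc -scalemxAr mxE.
  have Bd a a' : B (delta_mx 0 a) (delta_mx 0 a') = Dl a a'.
    by rewrite /B -rowE trmx_delta map_delta_mx -colE !mxE.
  rewrite -/(B z z) /z BDl !BDr !BZl !BZr !Bd Dii Djj Dji /c.
  case: (Dl i j) => x y; apply/eqP; rewrite eq_complex /sqnormC /=.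
  by apply/andP; split; apply/eqP; ring.
have g0 : (received b M0 Dl) q q = (sqnormC (b q r) * (2 * si * sj * sqnormC c))%:C.
  have YE : b *m M0 *m Ut *m diagC (map_mx Num.sqrt lt) = col r b *m z.
    by rewrite -vz colE /M0 !mulmxA.
  rewrite /received/= YE tcmxM !mulmxA.
  rewrite -(mulmxA (col r b) z) -(mulmxA (col r b) (z *m Dl)).
  rewrite [z *m Dl *m z^t*]mx11_scalar zDz mul_mx_scalar -scalemxAl.
  by rewrite mxE mxE big_ord1 !mxE [RHS]rmorphM/= [RHS]mulrC sqnormCE normCK.
pose x0 := coords_of_mx M0.
(* The filter generated by the boxes around [x0]: a property that holds along it holds on a box, in
   the form required by [gaussian_box_gt0]. *)
pose F : set_system (I -> R) := [set A | exists2 e : R, 0 < e &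
  forall x, (forall k, `|x k - x0 k| < e) -> A x].
have FF : Filter F.
  split.
  - by exists 1.
  - move=> A B [e1 e10 h1] [e2 e20 h2]; exists (Num.min e1 e2).
      by rewrite lt_min e10.
    move=> x hx; split; [apply: h1|apply: h2] => k.
      by apply: lt_le_trans (hx k) _; rewrite ge_min lexx.
    by apply: lt_le_trans (hx k) _; rewrite ge_min lexx orbT.
  - by move=> A B AB [e e0 h]; exists e => // x hx; apply: AB; exact: h.
have sF := cvg_subalgebra R x0 FF.
have coordF k : x k @[x --> F] --> x0 k.
  apply/cvgrPdist_lt => e e0; exists e => // x hx /=.
  by rewrite distrC.
have mxF : mx_in (fun f => f x @[x --> F] --> f x0) (fun x => mx_of_coords x).
  by move=> a a'; split; under eq_fun do rewrite mxE; rewrite mxE; exact: coordF.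
have [gF _] := mx_in_received Dl sF mxF q q.
have gx0 : complex.Re (received b (mx_of_coords x0) Dl q q) != 0.
  rewrite coords_of_mxK g0 /=.
  by rewrite gt_eqF// !mulr_gt0// sqnormC_gt0.
have [e e0 he] := cvgr_neq0 _ gF gx0.
(* The box lies in the null set on which the two covariances may differ, against its positive
   probability. *)
have [N1 [mN1 PN1 subN1]] := ae_eq.
have [mbox] := gaussian_box_gt0 sd_neq0 x0 e0 gZ.
rewrite ltNge => /negP; apply.
rewrite -PN1; apply: le_measure; rewrite ?inE//.
move=> w hw; apply: subN1 => /= eqw.
have := he _ hw; rewrite coords_of_mxK /Dl receivedD receivedN eqw subrr mxE/=.
by rewrite eqxx.
Qed.

End expected_gain.

(** * Optimization over the input covariance *)

Section optimization.
Context {R : realType} {n : nat}.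
Local Notation C := R[i].

Lemma psd_diagC (l : 'rV[R]_n) : (forall i, 0 <= l 0 i) -> psd (diagC l).
Proof.
move=> l0; have -> : diagC l =
    diagC (map_mx Num.sqrt l) *m (diagC (map_mx Num.sqrt l))^t*.
  rewrite diagC_tc diagC_mul; congr diagC; apply/rowP => i.
  by rewrite !mxE -expr2 sqr_sqrtr.
exact: psd_gram.
Qed.

Lemma source_diagC (l : 'rV[R]_n) : source_power (diagC l) = \sum_i l 0 i.
Proof.
rewrite /source_power /diagC mxtrace_diag.
have -> : \sum_i map_mx (real_complex R) l 0 i = (\sum_i l 0 i)%:C.
  by rewrite rmorph_sum; apply: eq_bigr => i _; rewrite mxE.
by [].
Qed.

Lemma psd_diagonal (W : 'M[C]_n) : psd W ->
  (forall i j, i != j -> W i j = 0) ->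
  exists2 l : 'rV[R]_n, (forall i, 0 <= l 0 i) & W = diagC l.
Proof.
move=> pW W0; exists (\row_i complex.Re (W i i)).
  by move=> i; rewrite mxE; have := psd_diag_ge0 i pW; rewrite lecE => /andP[].
apply/matrixP => i j; rewrite !mxE; have [<-|ij] := eqVneq i j; last by rewrite W0.
by rewrite mulr1n ge0_ReK// psd_diag_ge0.
Qed.

(** In a factorization [W = L L^H], the diagonal entry is the squared norm of row [i] of [L]. *)
Lemma psd_row0 (W : 'M[C]_n) i j : psd W -> complex.Re (W i i) <= 0 -> W i j = 0.
Proof.
move=> /psd_factor[L ->] h.
have Wii : (L *m L^t*) i i = (\sum_k sqnormC (L i k))%:C.
  rewrite mxE rmorph_sum; apply: eq_bigr => k _.
  by rewrite !mxE /= sqnormCE normCK.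
have L0 k : L i k = 0.
  apply/eqP; apply: contraTT h => Lik; rewrite Wii /= -ltNge.
  rewrite (bigD1 k)//= ltr_pwDl ?sqnormC_gt0// sumr_ge0// => k' _.
  exact: sqnormC_ge0.
by rewrite mxE big1// => k _; rewrite L0 mul0r.
Qed.

(** Clamping extends the diagonal problem from nonnegative rows to the whole space, where continuity
    is then unconditional. *)
Definition row_pos (l : 'rV[R]_n) : 'rV[R]_n := map_mx (Num.max 0) l.

Lemma row_pos_ge0 l i : 0 <= row_pos l 0 i.
Proof. by rewrite mxE le_max lexx. Qed.

Lemma row_pos_id (l : 'rV[R]_n) : (forall i, 0 <= l 0 i) -> row_pos l = l.
Proof. by move=> l0; apply/rowP => i; rewrite mxE max_r. Qed.

(** Clamping is 1-Lipschitz in each coordinate. This is the Loewner bound that the Lipschitz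
    hypotheses on [g] and [pw] take as input. *)
Lemma row_pos_dist (l l' : 'rV[R]_n) :
  psd (diagC (row_pos l') + (`|l - l'|%:C)%:M - diagC (row_pos l)).
Proof.
have -> : diagC (row_pos l') + (`|l - l'|%:C)%:M - diagC (row_pos l) =
    diagC (\row_i (row_pos l' 0 i + `|l - l'| - row_pos l 0 i)).
  apply/matrixP => i j; rewrite !mxE; case: eqP => _; rewrite ?mulr1n ?mulr0n.
    by rewrite rmorphB rmorphD.
  by rewrite addr0 subr0.
apply: psd_diagC => i; rewrite !mxE.
have : `|l 0 i - l' 0 i| <= `|l - l'|.
  have -> : l 0 i - l' 0 i = (l - l') 0 i by rewrite !mxE.
  rewrite [leRHS]mx_normrE.
  exact: (le_bigmax _ (fun k => `|(l - l') k.1 k.2|) (0, i)).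
rewrite ler_norml => /andP[h1 h2].
by case: (leP 0 (l 0 i)); case: (leP 0 (l' 0 i)); lra.
Qed.

Lemma lipschitz_continuous (f : 'rV[R]_n -> R) (c : R) :
  0 <= c -> (forall l l', f l <= f l' + `|l - l'| * c) -> continuous f.
Proof.
move=> c0 h l; apply/(@cvgrPdist_lt _ _ _ _ (nbhs_filter l)) => e e0.
(* The radius is [e / (c + 1)], because [c] may be 0. *)
have c1 : 0 < c + 1 by lra.
have ec : 0 < e / (c + 1) by rewrite divr_gt0.
apply/nbhs_ballP; exists (e / (c + 1)) => //= l'.
rewrite -ball_normE /= => d1.
have d2 : `|l - l'| * c < e.
  apply: (@le_lt_trans _ _ (`|l - l'| * (c + 1))).
    by rewrite ler_wpM2l// lerDl.
  by rewrite -ltr_pdivlMr.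
rewrite ltr_norml; have := h l l'; have := h l' l; rewrite distrC.
by move: d2; move: (`|l - l'| * c) => x; lra.
Qed.

Variables (g pw : 'M[C]_n -> R) (Pc PS PR RS cg cp : R).
Hypothesis Pc0 : 0 < Pc.
Hypothesis cg0 : 0 <= cg.
Hypothesis cp0 : 0 <= cp.
Hypothesis pw_ge0 : forall W, psd W -> 0 <= pw W.
Hypothesis g_decouple : forall i W, psd W -> g W <= g (decouple i W).
Hypothesis pw_decouple : forall i W, psd W -> pw (decouple i W) = pw W.
Hypothesis g_lip : forall W W' e, 0 <= e -> psd W -> psd W' ->
  psd (W' + (e%:C)%:M - W) -> g W <= g W' + e * cg.
Hypothesis pw_lip : forall W W' e, 0 <= e -> psd W -> psd W' ->
  psd (W' + (e%:C)%:M - W) -> pw W <= pw W' + e * cp.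

(** The problem for [W = Ut^H Q Ut], with an abstract mean gain [g] and relay power [pw]. *)
Definition feas (W : 'M[C]_n) : Prop :=
  [/\ pw W <= PR, source_power W <= PS, psd W & RS <= g W].

Definition eff (W : 'M[C]_n) : R := g W / (pw W + source_power W + Pc).

Lemma cost_gt0 W : psd W -> 0 < pw W + source_power W + Pc.
Proof.
move=> pW; rewrite ltr_wpDl// addr_ge0 ?pw_ge0//; exact: psd_Retr_ge0.
Qed.

Lemma decouple_better i W : feas W ->
  feas (decouple i W) /\ eff W <= eff (decouple i W).
Proof.
move=> [h1 h2 pW h4]; have pD := decouple_psd i pW.
have hg := g_decouple i pW; have hp := pw_decouple i pW.
split.
  by split; rewrite ?hp ?source_decouple//; apply: le_trans hg.
rewrite /eff hp source_decouple ler_wpM2r// invr_ge0 ltW//.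
exact: cost_gt0.
Qed.

Lemma diagonal_better W : feas W ->
  exists2 l : 'rV[R]_n, (forall i, 0 <= l 0 i) &
    feas (diagC l) /\ eff W <= eff (diagC l).
Proof.
move=> fW.
suff [W' [fW' ef W0]] : exists W', [/\ feas W', eff W <= eff W' &
    forall i j, i \in enum 'I_n -> i != j -> W' i j = 0 /\ W' j i = 0].
  have [_ _ pW' _] := fW'.
  have [|l l0 E] := psd_diagonal pW'.
    by move=> i j ij; have [] := W0 i j (mem_enum _ _) ij.
  by exists l; [exact: l0 | rewrite -E; split; [exact: fW'|exact: ef]].
(* Decoupling a further index only sets entries to zero, so the zeros obtained before persist. *)
elim: (enum 'I_n) => [|k s [W' [fW' ef W0]]]; first by exists W.
have [fD eD] := decouple_better k fW'.
exists (decouple k W'); split => //; first exact: le_trans eD.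
move=> i j; rewrite inE => /orP[/eqP ->|si] ij.
  by rewrite !mxE eqxx (eq_sym j) (negbTE ij).
by have [h1 h2] := W0 i j si ij; rewrite !mxE h1 h2; split; case: ifP.
Qed.

Lemma optimal_diagonal : (exists W, feas W) ->
  exists2 l : 'rV[R]_n, (forall i, 0 <= l 0 i) &
    feas (diagC l) /\ forall W, feas W -> eff W <= eff (diagC l).
Proof.
move=> [W /diagonal_better[l1 l1_ge0 [fl1 _]]].
pose gl l := g (diagC (row_pos l)); pose pl l := pw (diagC (row_pos l)).
pose sl l := source_power (diagC (row_pos l)).
have pr l : psd (diagC (row_pos l)) by apply: psd_diagC; exact: row_pos_ge0.
have cgl : continuous gl.
  apply: (lipschitz_continuous cg0) => l l'.
  by apply: g_lip => //; exact: row_pos_dist.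
have cpl : continuous pl.
  apply: (lipschitz_continuous cp0) => l l'.
  by apply: pw_lip => //; exact: row_pos_dist.
(* The constant [n] is the trace of the identity. *)
have csl : continuous sl.
  apply: (@lipschitz_continuous _ n%:R) => // l l'.
  have := psd_Retr_ge0 (row_pos_dist l l'); rewrite -/(source_power _).
  have sE (X : 'M[C]_n) (c : R) : source_power (c%:C *: X) = c * source_power X.
    by rewrite /source_power mxtraceZ; case: (\tr X) => x y /=; rewrite mul0r subr0.
  have s1 : source_power (1%:M : 'M[C]_n) = n%:R.
    by rewrite /source_power mxtrace1 -(rmorph_nat (real_complex R)).
  have sB (X Y : 'M[C]_n) : source_power (X - Y) = source_power X - source_power Y.
    by rewrite /source_power raddfB /=; case: (\tr X); case: (\tr Y).
  rewrite sB source_powerD -[(_%:C)%:M]scalemx1 sE s1.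
  rewrite /sl; move: (source_power _) (source_power _) (_ * _) => x y t; lra.
(* Nonnegative entries whose sum is at most [PS] lie in [[0, PS]], so this box loses no feasible
   row; the other constraints are closed. *)
pose L := [set l : 'rV[R]_n | forall i, `[0, PS]%classic (l 0 i)] `&`
  (pl @^-1` [set x | x <= PR] `&` (sl @^-1` [set x | x <= PS] `&`
   gl @^-1` [set x | RS <= x])).
have cL : compact L.
  apply: compact_closedI.
    by apply: (rV_compact (A := fun=> `[0, PS]%classic)) => _; exact: segment_compact.
  apply: closedI; first by apply: closed_comp => //; exact: closed_le.
  apply: closedI; first by apply: closed_comp => //; exact: closed_le.
  by apply: closed_comp => //; exact: closed_ge.
have LE (l : 'rV[R]_n) : (forall i, 0 <= l 0 i) -> feas (diagC l) -> L l.
  move=> l0 [h1 h2 h3 h4]; split => /=.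
    move=> i; rewrite in_itv/= l0/=; apply: le_trans h2.
    by rewrite source_diagC (bigD1 i)//= lerDl sumr_ge0.
  by rewrite /pl /sl /gl row_pos_id.
pose el l := gl l / (pl l + sl l + Pc).
have cel : continuous el.
  move=> l.
  have FF : Filter (nbhs l) := nbhs_filter l.
  have hc : pl l + sl l + Pc != 0 by rewrite gt_eqF//; exact: cost_gt0.
  have hd := cvgD (cvgD (cpl l) (csl l)) (cvg_cst Pc).
  exact: (cvgM (cgl l) (cvgV hc (hd _ _ _))).
have [|l2 Ll2 l2max] := compact_EVT_max _ cL (continuous_subspaceT cel).
  by exists l1; exact: LE.
move: Ll2; rewrite inE => -[/= l2i [l2p [l2s l2g]]].
have l2_ge0 i : 0 <= l2 0 i by have := l2i i; rewrite in_itv/= => /andP[].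
exists l2 => //; split.
  move: l2p l2s l2g; rewrite /pl /sl /gl/= row_pos_id// => h1 h2 h3.
  by split; [exact: h1|exact: h2|exact: psd_diagC|exact: h3].
move=> W' /diagonal_better[l3 l3_ge0 [fl3 e3]].
apply: (le_trans e3).
have := l2max l3; rewrite inE => /(_ (LE _ l3_ge0 fl3)).
by rewrite /el /gl /pl /sl !row_pos_id.
Qed.

Variable lt : 'rV[R]_n.
Hypothesis lt_ge0 : forall i, 0 <= lt 0 i.
Hypothesis g_erase : forall i W, lt 0 i = 0 -> g (erase_conj i W) = g W.
Hypothesis pw_erase : forall i W, lt 0 i = 0 -> pw (erase_conj i W) = pw W.
Hypothesis g_strict : forall i j W, psd W -> 0 < g W -> i != j -> W i j != 0 ->
  0 < lt 0 i -> 0 < lt 0 j -> g W < g (decouple i W).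

Lemma optimal_is_diagonal W : feas W -> (forall W', feas W' -> eff W' <= eff W) ->
  0 < g W -> exists2 l : 'rV[R]_n, (forall i, 0 <= l 0 i) & W = diagC l.
Proof.
move=> fW optW gW; have [h1 h2 pW h4] := fW.
have W0 i j : lt 0 i = 0 -> W i j = 0.
  move=> lti; apply: (psd_row0 _ pW); rewrite leNgt; apply/negP => Wii.
  have pE := erase_conj_psd i pW.
  have sE := source_erase i W.
  have fE : feas (erase_conj i W).
    by split => //; rewrite ?pw_erase ?g_erase// sE; lra.
  have := optW _ fE; rewrite leNgt => /negP; apply.
  (* A positive numerator turns the strictly smaller cost into a strictly larger quotient. *)
  rewrite /eff g_erase// pw_erase// ltr_pM2l// ltf_pV2 ?posrE ?cost_gt0//.
    by rewrite sE; lra.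
  by have := cost_gt0 pE; rewrite pw_erase.
apply: psd_diagonal => // i j ij; apply: contrapT => /eqP Wij.
have ltp k : lt 0 k != 0 -> 0 < lt 0 k by rewrite lt_def lt_ge0 andbT.
have [lti|/ltp lti] := eqVneq (lt 0 i) 0; first by rewrite W0 ?eqxx in Wij.
have [ltj|/ltp ltj] := eqVneq (lt 0 j) 0.
  have [/hermP/matrixP/(_ i j) hW _] := pW.
  by move: Wij; rewrite -hW !mxE W0// rmorph0 eqxx.
have [fD _] := decouple_better i fW.
have := optW _ fD; rewrite leNgt => /negP; apply.
rewrite /eff pw_decouple// source_decouple ltr_pM2r ?g_strict//.
  exact: (g_strict pW gW ij Wij lti ltj).
by rewrite invr_gt0 cost_gt0.
Qed.

End optimization.

(** * The relay channel *)

Lemma ln_Re_div (R : realType) (x y : R[i]) : 0 < x -> 0 < y ->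
  ln (complex.Re (x / y)) = ln (complex.Re x) - ln (complex.Re y).
Proof.
move=> x0 y0; have [hx hy] : 0 < complex.Re x /\ 0 < complex.Re y.
  by move: x0 y0; rewrite !ltcE => /andP[_ ->] /andP[_ ->].
rewrite -{1}(ge0_ReK (ltW x0)) -{1}(ge0_ReK (ltW y0)) -fmorphV -rmorphM /=.
by rewrite lnM ?posrE ?invr_gt0// lnV ?posrE.
Qed.

Section relay_channel.
Context {R : realType} {NS NR ND : nat}.
Local Notation C := R[i].
Variables (sR2 sD2 : R).
Hypotheses (hsR2 : 0 < sR2) (hsD2 : 0 < sD2).
Variables (Ur : 'M[C]_NR) (lr : 'rV[R]_NR) (Ut : 'M[C]_NS) (lt : 'rV[R]_NS).
Hypothesis UtU : Ut^t* *m Ut = 1%:M.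
Variables (G : 'M[C]_(ND, NR)) (A : 'M[C]_NR).

Definition noise_cov : 'M[C]_ND :=
  (sD2%:C)%:M + sR2%:C *: (G *m A *m A^t* *m G^t*).

Definition relay_gain : 'M[C]_(ND, NR) := G *m A *m evd_sqrt Ur lr.

(** The power that the relay spends on its own amplified noise, a constant independent of the input
    covariance. *)
Definition forwarded_noise : R := sR2 * complex.Re (\tr (A *m A^t*)).

Lemma noise_cov_ge : psd (noise_cov - (sD2%:C)%:M).
Proof.
rewrite /noise_cov addrAC subrr add0r; apply: psdZ; first exact: ltW.
by have := psd_gram (G *m A); rewrite tcmxM !mulmxA.
Qed.

Lemma forwarded_noise_ge0 : 0 <= forwarded_noise.
Proof. by rewrite mulr_ge0 ?(ltW hsR2)// psd_Retr_ge0//; exact: psd_gram. Qed.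

(** The inner factor [Ut^H Ut] cancels. The left factor is arbitrary because the identity is used
    with [G A] for the rate and with [A] for the relay power. *)
Lemma conj_received m (L : 'M[C]_(m, NR)) (M : 'M[C]_(NR, NS)) W :
  let H := evd_sqrt Ur lr *m M *m evd_sqrt Ut lt in
  L *m (H *m (Ut *m W *m Ut^t*) *m H^t*) *m L^t* =
  received Ut lt (L *m evd_sqrt Ur lr) M W.
Proof.
move=> H; rewrite /received/=.
have YE : L *m H *m Ut = L *m evd_sqrt Ur lr *m M *m Ut *m diagC (map_mx Num.sqrt lt).
  by rewrite /H {2}/evd_sqrt !mulmxA -(mulmxA _ (Ut^t*)) UtU mulmx1.
by rewrite -YE !tcmxM !mulmxA.
Qed.

Lemma log_det_ratio_gain (T : Type) (Z : T -> 'M[C]_(NR, NS)) w W : psd W ->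
  log_det_ratio sR2 sD2 G A (channel Ur lr Ut lt Z w) (Ut *m W *m Ut^t*) =
  gain Ut lt relay_gain noise_cov (Z w) W.
Proof.
move=> pW.
have E : (sD2%:C)%:M + G *m A *m
    rx_cov sR2 (channel Ur lr Ut lt Z w) (Ut *m W *m Ut^t*) *m A^t* *m G^t* =
    noise_cov + received Ut lt relay_gain (Z w) W.
  rewrite /rx_cov mulmxDr !mulmxDl mul_mx_scalar -!scalemxAl addrA addrAC.
  rewrite -/noise_cov; congr (_ + _).
  by rewrite /relay_gain -(conj_received (G *m A)) [(G *m A)^t*]tcmxM -[LHS]mulmxA.
have pK := received_psd Ut lt relay_gain (Z w) pW.
have d1 := pd_det_gt0 (ge_scalar_pd hsD2 noise_cov_ge).
have d2 := pd_det_gt0 (ge_scalar_pd hsD2 (ge_scalarD noise_cov_ge pK)).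
by rewrite /log_det_ratio E -/noise_cov ln_Re_div.
Qed.

Lemma relay_power_received (T : Type) (Z : T -> 'M[C]_(NR, NS)) w W :
  complex.Re (\tr (A *m rx_cov sR2 (channel Ur lr Ut lt Z w)
                       (Ut *m W *m Ut^t*) *m A^t*)) =
  received_power Ut lt (A *m evd_sqrt Ur lr) (Z w) W + forwarded_noise.
Proof.
rewrite /rx_cov mulmxDr mulmxDl mul_mx_scalar -scalemxAl conj_received.
rewrite raddfD/= complex_ReD mxtraceZ; congr (_ + _).
by rewrite /forwarded_noise; case: (\tr _) => x y /=; rewrite mul0r subr0.
Qed.

Lemma source_power_conj (W : 'M[C]_NS) :
  source_power (Ut *m W *m Ut^t*) = source_power W.
Proof. by rewrite /source_power mxtrace_mulC mulmxA UtU mul1mx. Qed.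

Context {d : measure_display} {T : measurableType d}.
Variable P : probability T R.
Variable Z : T -> 'M[C]_(NR, NS).
Hypothesis gZ :
  gaussian_family P (Num.sqrt (1 / 2 : R)) (fun w => coords_of_mx (Z w)).

Local Notation H := (channel Ur lr Ut lt Z).

Lemma rate_mean_gain W : psd W ->
  rate P sR2 sD2 G H A (Ut *m W *m Ut^t*) =
  mean_gain P Z Ut lt relay_gain noise_cov W.
Proof.
move=> pW; rewrite /rate /mean_gain /Rintegral unlock; congr fine.
by apply: eq_integral => w _; rewrite log_det_ratio_gain.
Qed.

Lemma relay_power_mean W : psd W ->
  relay_power P sR2 H A (Ut *m W *m Ut^t*) =
  mean_power P Z Ut lt (A *m evd_sqrt Ur lr) W + forwarded_noise.
Proof.
move=> pW; rewrite /relay_power unlock.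
transitivity (\int[P]_w (received_power Ut lt (A *m evd_sqrt Ur lr) (Z w) W
  + forwarded_noise)).
  congr fine; apply: eq_integral => w _; congr EFin; exact: relay_power_received.
have I1 := integrable_received_power gZ Ut lt (A *m evd_sqrt Ur lr) pW.
have I2 : P.-integrable [set: T] (EFin \o (fun=> forwarded_noise)).
  exact: finite_measure_integrable_cst.
rewrite (RintegralD measurableT I1 I2); congr (_ + _).
rewrite Rintegral_cst// [X in fine X](_ : _ = 1%E) ?mulr1//.
exact: (@probability_setT _ _ _ P).
Qed.

End relay_channel.

(** Optimal points need not be unique. If [G A R_r^(1/2) = 0], the rate vanishes identically and
    every feasible [Q] is optimal, whatever its eigenvectors. Hence the two claims: some optimum has
    the eigenvectors [Ut], and every optimum with positive rate has them. *)
Theorem proposition3 (R : realType) (d : measure_display)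
    (T : measurableType d) (P : probability T R) (NS NR ND : nat)
    (sR2 sD2 Pc PSmax PRmax RSmin : R)
    (hsR2 : 0 < sR2) (hsD2 : 0 < sD2) (hPc : 0 < Pc)
    (hPSmax : 0 < PSmax) (hPRmax : 0 < PRmax) (hRSmin : 0 <= RSmin)
    (Rr Ur : 'M[R[i]]_NR) (lr : 'rV[R]_NR)
    (Rt Ut : 'M[R[i]]_NS) (lt : 'rV[R]_NS)
    (hRr : psd Rr) (hevdr : evd Ur lr Rr) (hlr : decreasing lr)
    (hRt : psd Rt) (hevdt : evd Ut lt Rt) (hlt : decreasing lt)
    (Z : T -> 'M[R[i]]_(NR, NS)) (hZ : iid_standard_complex_gaussian P Z)
    (G : 'M[R[i]]_(ND, NR)) (A : 'M[R[i]]_NR) :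
  let H := channel Ur lr Ut lt Z in
  ((exists Q, feasible P sR2 sD2 PSmax PRmax RSmin G H A Q) ->
   exists Q, optimal_for P sR2 sD2 Pc PSmax PRmax RSmin G H A Q /\
             has_eigenvectors Ut Q) /\
  (forall Q, optimal_for P sR2 sD2 Pc PSmax PRmax RSmin G H A Q ->
             0 < rate P sR2 sD2 G H A Q ->
             has_eigenvectors Ut Q).
Proof.
have [uU lt0 _] := hevdt.
have UUt : Ut *m Ut^t* = 1%:M by apply/unitarymxP.
have UtU : Ut^t* *m Ut = 1%:M by exact: mulmx1C.
have gZ := iid_gaussian_family hZ.
move=> H.
pose B := relay_gain Ur lr G A; pose N := noise_cov sR2 sD2 G A.
pose L := A *m evd_sqrt Ur lr; pose c := forwarded_noise sR2 A.
pose g W := mean_gain P Z Ut lt B N W.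
pose pw W := mean_power P Z Ut lt L W + c.
have pN : psd (N - (sD2%:C)%:M) by exact: noise_cov_ge.
have c0 : 0 <= c by exact: forwarded_noise_ge0.
have cg0 : 0 <= mean_power P Z Ut lt B 1%:M / sD2.
  exact: (divr_ge0 (mean_power_ge0 P Z Ut lt B (psd1 NS)) (ltW hsD2)).
have cp0 : 0 <= mean_power P Z Ut lt L 1%:M := mean_power_ge0 P Z Ut lt L (psd1 NS).
have pw_ge0 W : psd W -> 0 <= pw W.
  by move=> pW; exact: (addr_ge0 (mean_power_ge0 P Z Ut lt L pW) c0).
have g_dec i W : psd W -> g W <= g (decouple i W).
  by move=> pW; exact: (proj1 (mean_gain_decouple gZ lt UtU B hsD2 pN i pW)).
have pw_dec i W : psd W -> pw (decouple i W) = pw W.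
  by move=> pW; exact: (congr1 (+%R^~ c) (mean_power_decouple gZ lt UtU L i pW)).
have g_lip W W' e : 0 <= e -> psd W -> psd W' -> psd (W' + (e%:C)%:M - W) ->
    g W <= g W' + e * (mean_power P Z Ut lt B 1%:M / sD2).
  move=> e0 pW pW' pd.
  have := mean_gain_lipschitz gZ Ut lt B hsD2 pN e0 pW pW' pd.
  by rewrite mulrAC -mulrA.
have pw_lip W W' e : 0 <= e -> psd W -> psd W' -> psd (W' + (e%:C)%:M - W) ->
    pw W <= pw W' + e * mean_power P Z Ut lt L 1%:M.
  move=> e0 pW pW' pd.
  have := mean_power_lipschitz gZ Ut lt L e0 pW pW' pd.
  by rewrite /pw addrAC lerD2r.
have g_er i W : lt 0 i = 0 -> g (erase_conj i W) = g W.
  by move=> lti; exact: (mean_gain_erase P Z Ut B N W lti).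
have pw_er i W : lt 0 i = 0 -> pw (erase_conj i W) = pw W.
  by move=> lti; exact: (congr1 (+%R^~ c) (mean_power_erase P Z Ut L W lti)).
have g_str i j W : psd W -> 0 < g W -> i != j -> W i j != 0 ->
    0 < lt 0 i -> 0 < lt 0 j -> g W < g (decouple i W).
  move=> pW gW ij Wij lti ltj; rewrite ltNge; apply/negP => le_g.
  (* A zero effective channel would give zero gain; a nonzero entry of [B] is what the perturbation
     argument needs. *)
  have B0 : B != 0.
    by apply: contraTneq gW => B0; rewrite /g mean_gain0// ltxx.
  have := proj2 (mean_gain_decouple gZ lt UtU B hsD2 pN i pW) le_g.
  exact: (received_flip_not_ae gZ UtU pW B0 ij Wij lti ltj).
(* The change of variable [Q = Ut W Ut^H] matches the two feasible sets and efficiencies, and a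
   diagonal [W] with nonnegative entries is a decomposition of [Q] along [Ut]. *)
pose U W := Ut *m W *m Ut^t*.
have UK Q : U (Ut^t* *m Q *m Ut) = Q.
  by rewrite /U !mulmxA UUt mul1mx -mulmxA UUt mulmx1.
have pU W : psd W -> psd (U W) by exact: psd_congr.
have pUi W : psd (U W) -> psd W.
  move=> /(psd_congr (Ut^t*)); rewrite trmxCK /U !mulmxA UtU mul1mx.
  by rewrite -mulmxA UtU mulmx1.
have rateE W : psd W -> rate P sR2 sD2 G H A (U W) = g W.
  by move=> pW; exact: rate_mean_gain.
have powE W : psd W -> relay_power P sR2 H A (U W) = pw W.
  by move=> pW; exact: relay_power_mean.
have srcE W : source_power (U W) = source_power W by exact: source_power_conj.
have feasE W : feasible P sR2 sD2 PSmax PRmax RSmin G H A (U W) <->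
    feas g pw PSmax PRmax RSmin W.
  split=> [[h1 h2 /pUi pW h4]|[h1 h2 pW h4]].
    rewrite (powE W pW) in h1; rewrite srcE in h2; rewrite (rateE W pW) in h4.
    by split; [exact: h1|exact: h2|exact: pW|exact: h4].
  rewrite -(powE W pW) in h1; rewrite -srcE in h2; rewrite -(rateE W pW) in h4.
  by split; [exact: h1|exact: h2|exact: (pU W pW)|exact: h4].
have effE W : psd W ->
    energy_efficiency P sR2 sD2 Pc G H A (U W) = eff g pw Pc W.
  by move=> pW; rewrite /energy_efficiency (rateE W pW) (powE W pW) srcE.
have psdU Q : psd Q -> psd (Ut^t* *m Q *m Ut) by move=> pQ; apply: pUi; rewrite UK.
split.
  move=> [Q fQ].
  have [|l l0 [fl optl]] := optimal_diagonal hPc cg0 cp0 pw_ge0 g_dec pw_dec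
      g_lip pw_lip
      (PS := PSmax) (PR := PRmax) (RS := RSmin).
    by exists (Ut^t* *m Q *m Ut); apply/feasE; rewrite UK.
  exists (U (diagC l)); split; last by exists Ut, l.
  split; first exact/feasE.
  move=> Q' fQ'; have [_ _ pQ' _] := fQ'.
  rewrite -(UK Q') (effE _ (psdU _ pQ')) (effE _ (psd_diagC l0)).
  by apply: optl; apply/feasE; rewrite UK.
move=> Q [fQ optQ] rQ; have [_ _ pQ _] := fQ.
have pW := psdU Q pQ; set W := Ut^t* *m Q *m Ut in pW.
have fW : feas g pw PSmax PRmax RSmin W by apply/feasE; rewrite UK.
have gW : 0 < g W by rewrite -[Q]UK (rateE _ pW) in rQ.
have [W' fW'|l l0 WE] := optimal_is_diagonal hPc pw_ge0 g_dec pw_dec lt0 g_er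
    pw_er g_str fW _ gW.
  have [_ _ pW' _] := fW'.
  rewrite -(effE _ pW') -(effE _ pW) UK; apply: optQ; exact/feasE.
exists Ut, l; split; last by [].
by split; [exact: uU|exact: l0|rewrite -[Q]UK -/W WE].
Qed.
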